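(* Each of the following three classes of finite 3-hypertournaments has a Ramsey expansion in a finite relational language: the cyclic class (4-constrained with $S=\{\mathbf C_4\}$), the even class (4-constrained with $S=\{\mathbf C_4,\mathbf H_4\}$), and the class of all finite 3-hypertournaments (4-constrained with $S=\{\mathbf C_4,\mathbf O_4,\mathbf H_4\}$). More concretely: (1) the class $\overrightarrow{\mathcal C_c}$ is Ramsey; (2) the class $\overrightarrow{\mathcal C_e}$ is Ramsey; (3) the class of all finite linearly ordered 3-hypertournaments $(A,R,\leq)$ (where $(A,R)$ is a 3-hypertournament and $\leq$ is a linear order on $A$) is Ramsey.
   Context: All languages are relational; embeddings are injective maps preserving and reflecting all relations (including the order, when present). A 3-hypertournament is a structure $\mathbf A=(A,R)$ with a single ternary relation $R$ such that for every 3-element set $S\subseteq A$ the automorphism group of the substructure induced on $S$ is exactly $\mathrm{Alt}(S)$; equivalently, on each 3-set $\{a,b,c\}$ exactly one of the two cyclic orientations is chosen, i.e. exactly one of $(a,b,c),(a,c,b)$ is in $R$, and $R$ is closed under cyclic rotation of triples. Given a linear order $\leq$ on a 3-hypertournament $T$, the associated 3-uniform hypergraph has hyperedge $\{a,b,c\}$ (with $a<b<c$) iff $(a,b,c)\in R$. The three isomorphism types of 3-hypertournaments on 4 vertices are: $\mathbf H_4$, the one whose automorphism group is $\mathrm{Alt}(4)$ (in any linear order its hypergraph has exactly two hyperedges, which intersect in vertices $a<b$ with exactly one vertex strictly between $a$ and $b$); $\mathbf O_4$, the one whose hypergraph has an odd number of hyperedges in any (equivalently, some) linear order; and $\mathbf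 C_4$, the cyclic one, which admits a linear order in which its hypergraph has all four hyperedges. For a nonempty $S\subseteq\{\mathbf H_4,\mathbf O_4,\mathbf C_4\}$, the 4-constrained class given by $S$ consists of all finite 3-hypertournaments all of whose substructures on 4 distinct vertices are isomorphic to a member of $S$. For structures $\mathbf A,\mathbf B,\mathbf C$, $\mathbf C\longrightarrow(\mathbf B)^{\mathbf A}_2$ means: for every 2-colouring of the embeddings $\mathbf A\to\mathbf C$ there is an embedding $f:\mathbf B\to\mathbf C$ such that all embeddings of $\mathbf A$ into $\mathbf C$ that factor through $f$ (i.e. of the form $f\circ g$ with $g:\mathbf A\to \mathbf B$ an embedding) have the same colour. A class $\mathcal C$ of finite structures is Ramsey if for all $\mathbf A,\mathbf B\in\mathcal C$ there is $\mathbf C\in\mathcal C$ with $\mathbf C\longrightarrow(\mathbf B)^{\mathbf A}_2$. A class $\mathcal C^+$ is a Ramsey expansion of $\mathcal C$ if it is Ramsey and is obtained from $\mathcal C$ by adding relations (i.e. its members are expansions of members of $\mathcal C$ by extra relations, and the reducts to the original language are exactly the members of $\mathcal C$). $\overrightarrow{\mathcal C_c}$ is the class of finite structures $(A,R,\leq)$ where $(A,R)$ is a 3-hypertournament, $\leq$ is a linear order on $A$, and for all $x<y<z$ in $A$ we have $(x,y,z)\in R$. $\overrightarrow{\mathcal C_e}$ is the class of finite structures $(A,\leq,E,R)$ such that $(A,\leq)$ is a linear order, $(A,E)$ is a graph, $(A,R)$ is a 3-hypertournament, and for all $a<b<c$ in $A$, $(a,b,c)\in R$ if and only if the number of $E$-edges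 among the pairs of $\{a,b,c\}$ is even (otherwise $(a,c,b)\in R$). *)

(* Defs.v *)
From HB Require Import structures.
From Stdlib Require List.
From mathcomp Require Import all_boot all_fingroup all_solvable.

Set Implicit Arguments.
Unset Strict Implicit.
Unset Printing Implicit Defensive.

(** * Finite relational languages, finite structures, embeddings *)

Record language := Language { symbol :> finType; arity : symbol -> nat }.

Definition language_add (L M : language) : language :=
  @Language (L + M)%type
    (fun s => match s with inl s => arity s | inr s => arity s end).

Record structure (L : language) := Structure {
  carrier :> finType;
  interp : forall s : L, pred ((arity s).-tuple carrier)
}.

Definition class (L : language) := structure L -> Prop.

Section Embeddings.
Variable L : language.

Definition is_embedding (A B : structure L) (f : A -> B) : bool :=
  injectiveb f &&
  [forall s : L, forall t : (arity s).-tuple A,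
     interp (map_tuple f t) == interp t].

Definition embedding (A B : structure L) :=
  {f : {ffun A -> B} | is_embedding f}.

Lemma comp_is_embedding (A B C : structure L)
    (f : embedding B C) (g : embedding A B) :
  is_embedding [ffun x => val f (val g x)].
Proof.
case: f => f /= /andP[/injectiveP f_inj /forallP fP].
case: g => g /= /andP[/injectiveP g_inj /forallP gP].
apply/andP; split.
  by apply/injectiveP=> x y; rewrite !ffunE => /f_inj/g_inj.
apply/forallP=> s; apply/forallP=> t.
rewrite -(eqP (forallP (gP s) t)) -(eqP (forallP (fP s) (map_tuple g t))).
apply/eqP; congr (interp _); apply: val_inj => /=.
by rewrite -map_comp; apply: eq_map => x; rewrite ffunE.
Qed.

Definition comp_embedding (A B C : structure L)
    (f : embedding B C) (g : embedding A B) : embedding A C :=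
  exist (fun h : {ffun A -> C} => is_embedding h)
    [ffun x => val f (val g x)] (comp_is_embedding f g).

Definition automorphisms (A : structure L) : {set {perm A}} :=
  [set p : {perm A} | is_embedding p].

Definition induced (A : structure L) (X : {set A}) : structure L :=
  @Structure L {x : A | x \in X} (fun s t => interp (map_tuple val t)).

(** [C --> (B)^A_2] *)
Definition arrows (C B A : structure L) : Prop :=
  forall chi : embedding A C -> bool,
    exists f : embedding B C, forall g h : embedding A B,
      chi (comp_embedding f g) = chi (comp_embedding f h).

Definition ramsey (K : class L) : Prop :=
  forall A B, K A -> K B -> exists2 C, K C & arrows C B A.

End Embeddings.

Definition reduct (L M : language) (A : structure (language_add L M)) :
    structure L :=
  @Structure L A (fun s => @interp _ A (inl s)).

Definition expansion_of (L M : language)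
    (K : class L) (Kplus : class (language_add L M)) : Prop :=
  (forall A, Kplus A -> K (reduct A)) /\
  (forall A, K A -> exists2 Aplus, Kplus Aplus & reduct Aplus = A).

Definition ramsey_expansion (L M : language)
    (K : class L) (Kplus : class (language_add L M)) : Prop :=
  ramsey Kplus /\ expansion_of K Kplus.

(** A [language] has finitely many symbols, so the added language is finite. *)
Definition has_finite_ramsey_expansion (L : language) (K : class L) : Prop :=
  exists (M : language) (Kplus : class (language_add L M)),
    ramsey_expansion K Kplus.

(** * 3-hypertournaments *)

Definition ht_language : language := @Language unit (fun=> 3).

Definition htR (A : structure ht_language) (x y z : A) : bool :=
  @interp ht_language A tt [tuple x; y; z].

(** The condition on automorphism groups says nothing about triples with a
    repeated entry; as usual, such triples are not in the relation. *)
Definition is_hypertournament : class ht_language := fun A =>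
  (forall x y z : A, htR x y z -> uniq [:: x; y; z]) /\
  (forall X : {set A}, #|X| = 3 ->
     automorphisms (induced X) = ('Alt_(induced X))%g).

Lemma mem_automorphisms (A : structure ht_language) (p : {perm A}) :
  reflect (forall x y z : A, htR (p x) (p y) (p z) = htR x y z)
          (p \in automorphisms A).
Proof.
rewrite inE /is_embedding; apply: (iffP andP) => [[_ /forallP/(_ tt)/forallP H] x y z|H].
  have /eqP := H [tuple x; y; z]; rewrite /htR => <-.
  by congr (interp _); apply: val_inj.
split; first by apply/injectiveP; apply: perm_inj.
apply/forallP=> -[]; apply/forallP => t; move: (t : 3.-tuple A) => {}t.
have [x [y [z ->]]] : exists x y z : A, t = [tuple x; y; z].
  case: t => -[|x [|y [|z []]]] //= st; exists x, y, z; exact: val_inj.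
apply/eqP; rewrite -[RHS]/(htR x y z) -H /htR.
by congr (interp _); apply: val_inj.
Qed.

Lemma perm3_cases (T : finType) (a b c : T) (p : {perm T}) :
  uniq [:: a; b; c] -> (forall x, x \in [:: a; b; c]) ->
  ~~ odd_perm p /\ (p a, p b, p c) \in [:: (a, b, c); (b, c, a); (c, a, b)] \/
  odd_perm p /\ (p a, p b, p c) \in [:: (a, c, b); (b, a, c); (c, b, a)].
Proof.
move=> U all3.
have ext (q : {perm T}) : p a = q a -> p b = q b -> p c = q c -> p = q.
  by move=> qa qb qc; apply/permP => x; have := all3 x; rewrite !inE => /or3P[]/eqP->.
move: U; rewrite /= !inE negb_or andbT => /andP[/andP[ab ac] bc].
have ba: b != a by rewrite eq_sym. have ca: c != a by rewrite eq_sym.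
have cb: c != b by rewrite eq_sym.
have N := (negbTE ab, negbTE ac, negbTE bc, negbTE ba, negbTE ca, negbTE cb).
have pN : (p a == p b) = false /\ (p a == p c) = false /\ (p b == p c) = false.
  by rewrite !(inj_eq perm_inj) !N.
have E x y z : (tperm x y z : T) = if z == x then y else if z == y then x else z.
  by rewrite permE.
move: pN => [p1 [p2 p3]].
have := all3 (p a); have := all3 (p b); have := all3 (p c).
rewrite !inE => /or3P[]/eqP pc /or3P[]/eqP pb /or3P[]/eqP pa;
  rewrite pa pb pc ?eqxx in p1 p2 p3 => //.
all: rewrite pa pb pc !xpair_eqE !N !eqxx /= ?orbT.
- right; split=> //; have -> : p = tperm a c; last by rewrite odd_tperm.
  by apply: ext; rewrite E ?pa ?pb ?pc ?eqxx ?N ?eqxx ?N.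
- left; split=> //; have -> : p = (tperm a b * tperm a c)%g.
    by apply: ext; rewrite permM !E ?pa ?pb ?pc ?eqxx ?N ?eqxx ?N.
  by rewrite odd_permM !odd_tperm !N.
- left; split=> //; have -> : p = (tperm a c * tperm a b)%g.
    by apply: ext; rewrite permM !E ?pa ?pb ?pc ?eqxx ?N ?eqxx ?N.
  by rewrite odd_permM !odd_tperm !N.
- right; split=> //; have -> : p = tperm b c; last by rewrite odd_tperm.
  by apply: ext; rewrite E ?pa ?pb ?pc ?eqxx ?N ?eqxx ?N.
- right; split=> //; have -> : p = tperm a b; last by rewrite odd_tperm.
  by apply: ext; rewrite E ?pa ?pb ?pc ?eqxx ?N ?eqxx ?N.
- left; split=> //; have -> : p = 1%g; last by rewrite odd_perm1.
  by apply: ext; rewrite perm1.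
Qed.

Lemma htR_induced (A : structure ht_language) (X : {set A}) (x y z : induced X) :
  htR x y z = htR (val x) (val y) (val z).
Proof. by rewrite /htR /=; congr (interp _); apply: val_inj. Qed.

Lemma card3E (A : structure ht_language) (X : {set A}) : #|X| = 3 ->
  exists a b c : induced X, uniq [:: a; b; c] /\ (forall x, x \in [:: a; b; c]).
Proof.
move=> X3; have c3 : #|induced X| = 3 by rewrite /= card_sig -X3; apply: eq_card.
have := cardE (induced X); rewrite c3.
have := enum_uniq (induced X); have := @mem_enum (induced X) predT.
case: (enum (induced X)) => [|a [|b [|c []]]] //= H U _.
by exists a, b, c; split=> // x; rewrite H.
Qed.

Lemma alt3 (A : structure ht_language) (a b c : A) :
  (forall x y z : A, htR x y z -> uniq [:: x; y; z]) ->
  uniq [:: a; b; c] -> (forall x, x \in [:: a; b; c]) ->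
  automorphisms A = ('Alt_A)%g <->
  [/\ htR a b c = htR b c a, htR a b c = htR c a b,
      htR a c b = htR c b a, htR a c b = htR b a c & htR a c b = ~~ htR a b c].
Proof.
move=> HU U all3.
have R1 (x y : A) : htR x x y = false.
  by apply/negP => /HU; rewrite /= !inE eqxx.
have R2 (x y : A) : htR x y x = false.
  by apply/negP => /HU; rewrite /= !inE eqxx orbT.
have R3 (x y : A) : htR y x x = false.
  by apply/negP => /HU; rewrite /= !inE eqxx andbF.
split=> [E|[h1 h2 h3 h4 h5]].
  have ev p : p \in ('Alt_A)%g -> forall x y z, htR (p x) (p y) (p z) = htR x y z.
    by rewrite -E => /mem_automorphisms.
  move: (U); rewrite /= !inE negb_or andbT => /andP[/andP[ab ac] bc].
  have ba: b != a by rewrite eq_sym. have ca: c != a by rewrite eq_sym.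
  have cb: c != b by rewrite eq_sym.
  have N := (negbTE ab, negbTE ac, negbTE bc, negbTE ba, negbTE ca, negbTE cb).
  have Ep x y z : (tperm x y z : A) = if z == x then y else if z == y then x else z.
    by rewrite permE.
  pose p := (tperm a b * tperm a c)%g.
  have pa : p a = b by rewrite permM !Ep ?eqxx ?N ?eqxx ?N.
  have pb : p b = c by rewrite permM !Ep ?eqxx ?N ?eqxx ?N.
  have pc : p c = a by rewrite permM !Ep ?eqxx ?N ?eqxx ?N.
  have pA : p \in ('Alt_A)%g by rewrite Alt_even odd_permM !odd_tperm !N.
  have e := ev p pA.
  have r1 : htR b c a = htR a b c by rewrite -(e a b c) pa pb pc.
  have r2 : htR c a b = htR b c a by rewrite -(e b c a) pa pb pc.
  have r3 : htR b a c = htR a c b by rewrite -(e a c b) pa pb pc.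
  have r4 : htR c b a = htR b a c by rewrite -(e b a c) pa pb pc.
  split; rewrite ?r2 ?r1 ?r4 ?r3 //.
  have qN : tperm b c \notin automorphisms A by rewrite E Alt_even odd_tperm bc.
  apply: contraNeq qN => hne.
  have {hne} h : htR a c b = htR a b c by move: hne; case: (htR a c b); case: (htR a b c).
  have qa : tperm b c a = a by rewrite Ep !N.
  have qb : tperm b c b = c by rewrite Ep !N eqxx.
  have qc : tperm b c c = b by rewrite Ep !N eqxx.
  apply/mem_automorphisms => x y z.
  move: (all3 x) (all3 y) (all3 z); rewrite !inE.
  by move=> /or3P[]/eqP-> /or3P[]/eqP-> /or3P[]/eqP->;
    rewrite ?qa ?qb ?qc ?R1 ?R2 ?R3 // ?r2 ?r4 ?r1 ?r3 ?h.
apply/setP => p; rewrite Alt_even; apply/mem_automorphisms/idP.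
  case: (perm3_cases p U all3) => [[-> _]//|[_]].
  by rewrite !inE !xpair_eqE => /or3P[] /andP[/andP[/eqP pa /eqP pb]/eqP pc];
   move/(_ a b c); rewrite pa pb pc -?h4 -?h3 h5; case: (htR a b c).
case: (perm3_cases p U all3) => [[_]|[-> _]//].
rewrite !inE !xpair_eqE => /or3P[] /andP[/andP[/eqP pa /eqP pb]/eqP pc] _ x y z;
  move: (all3 x) (all3 y) (all3 z); rewrite !inE;
  by move=> /or3P[]/eqP-> /or3P[]/eqP-> /or3P[]/eqP->;
    rewrite ?pa ?pb ?pc ?R1 ?R2 ?R3 -?h1 -?h2 -?h3 -?h4.
Qed.

Lemma hypertournamentP (A : structure ht_language) :
  is_hypertournament A <->
  [/\ forall x y z : A, htR x y z -> uniq [:: x; y; z],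
      forall x y z : A, htR x y z = htR y z x &
      forall x y z : A, uniq [:: x; y; z] -> htR x z y = ~~ htR x y z].
Proof.
have UI (X : {set A}) : (forall x y z : A, htR x y z -> uniq [:: x; y; z]) ->
   forall x y z : induced X, htR x y z -> uniq [:: x; y; z].
  by move=> HU x y z; rewrite htR_induced => /HU; rewrite /= !inE.
split=> [[HU H]|[HU Hr Ha]]; last first.
  split=> // X /card3E [a [b [c [U all3]]]].
  apply/(alt3 (UI X HU) U all3); rewrite !htR_induced; split.
  - exact: Hr.
  - by rewrite -Hr.
  - exact: Hr.
  - by rewrite -Hr.
  - by apply: Ha; move: U; rewrite /= !inE.
have K (x y z : A) : uniq [:: x; y; z] ->
   htR x y z = htR y z x /\ htR x z y = ~~ htR x y z.
  move=> U; pose X := [set x; y; z].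
  have xX : x \in X by rewrite !inE eqxx.
  have yX : y \in X by rewrite !inE eqxx orbT.
  have zX : z \in X by rewrite !inE eqxx orbT.
  have X3 : #|X| = 3.
    have -> : #|X| = #|[:: x; y; z]| by apply: eq_card => u; rewrite !inE orbA.
    by rewrite (card_uniqP U).
  have U' : uniq [:: exist _ x xX; exist _ y yX; exist _ z zX : induced X].
    by move: U; rewrite /= !inE.
  have all3 (u : induced X) : u \in [:: exist _ x xX; exist _ y yX; exist _ z zX : induced X].
    by have := valP u; rewrite !inE -orbA.
  by have [] := (alt3 (UI X HU) U' all3).1 (H X X3); rewrite !htR_induced.
split=> // x y z; last by case/K.
have [|N] := boolP (uniq [:: x; y; z]); first by case/K.
have N' : ~~ uniq [:: y; z; x] by have := rot_uniq 1 [:: x; y; z]; rewrite /rot /= => ->.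
have -> : htR x y z = false by apply/negP => /HU; apply/negP.
by symmetry; apply/negP => /HU; apply/negP.
Qed.

Definition linear_order (T : Type) (le : rel T) : Prop :=
  [/\ reflexive le, antisymmetric le, transitive le & total le].

Definition strict (T : eqType) (le : rel T) : rel T :=
  fun x y => (x != y) && le x y.

Definition hyperedges (A : structure ht_language) (le : rel A) :
    {set {set A}} :=
  [set X : {set A} | [exists a : A, exists b : A, exists c : A,
     [&& X == [set a; b; c], strict le a b, strict le b c & htR a b c]]].

(** The isomorphism types of the 3-hypertournaments on 4 vertices, each given
    as the class of the structures of that type. *)

Definition H4 : class ht_language := fun A =>
  [/\ #|A| = 4, is_hypertournament A & automorphisms A = ('Alt_A)%g].

Definition O4 : class ht_language := fun A =>
  [/\ #|A| = 4, is_hypertournament A &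
      forall le : rel A, linear_order le -> odd #|hyperedges le|].

Definition C4 : class ht_language := fun A =>
  [/\ #|A| = 4, is_hypertournament A &
      exists2 le : rel A, linear_order le &
        forall X : {set A}, #|X| = 3 -> X \in hyperedges le].

Definition four_constrained (S : seq (class ht_language)) :
    class ht_language := fun A =>
  is_hypertournament A /\
  forall X : {set A}, #|X| = 4 -> exists2 K, List.In K S & K (induced X).

Definition cyclic_class := four_constrained [:: C4].
Definition even_class := four_constrained [:: C4; H4].
Definition all_class := four_constrained [:: C4; O4; H4].

(** * The concrete expansions *)

Definition order_language : language := @Language unit (fun=> 2).

Definition leR (A : structure (language_add ht_language order_language)) :
    rel A :=
  fun x y => @interp _ A (inr tt) [tuple x; y].

Definition ordered_hypertournaments :
    class (language_add ht_language order_language) := fun A =>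
  is_hypertournament (reduct A) /\ linear_order (@leR A).

Definition ordered_cyclic :
    class (language_add ht_language order_language) := fun A =>
  [/\ is_hypertournament (reduct A), linear_order (@leR A) &
      forall x y z : A, strict (@leR A) x y -> strict (@leR A) y z ->
        @htR (reduct A) x y z].

Definition graph_language : language := @Language unit (fun=> 2).

Definition order_graph_language : language :=
  language_add order_language graph_language.

Definition ogLe
    (A : structure (language_add ht_language order_graph_language)) : rel A :=
  fun x y => @interp _ A (inr (inl tt)) [tuple x; y].

Definition ogE
    (A : structure (language_add ht_language order_graph_language)) : rel A :=
  fun x y => @interp _ A (inr (inr tt)) [tuple x; y].

Definition ordered_even :
    class (language_add ht_language order_graph_language) := fun A =>
  [/\ linear_order (@ogLe A),
      irreflexive (@ogE A) /\ symmetric (@ogE A),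
      is_hypertournament (reduct A) &
      forall a b c : A, strict (@ogLe A) a b -> strict (@ogLe A) b c ->
        let n := (ogE a b + ogE b c + ogE a c)%N in
        @htR (reduct A) a b c = ~~ odd n /\ @htR (reduct A) a c b = odd n].

(* Main.v *)
From mathcomp Require Import all_boot all_fingroup all_solvable zify.
Require Import Defs.

(** A linear order turns a 3-hypertournament into a 3-uniform hypergraph, and the
    members of [ordered_even] into ordered graphs, so everything reduces to the
    Ramsey property of ordered [k]-uniform hypergraphs. This is obtained by the
    partite construction of Nesetril and Rodl: for one placement of [A] in the
    parts, the Hales-Jewett theorem on the alphabet of all copies of [A] with that
    placement makes the colour constant; iterating over all placements leaves a
    colouring of the placements only, to which the finite Ramsey theorem applies.
    The usual amalgamation step is absorbed in a power construction with undefined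
    coordinates, see [power_edge].

    For the expansions, the parity of the number of hyperedges on four points
    distinguishes [O4] from [C4] and [H4]. The cyclic class is ordered by cutting
    the cyclic order at a point [v], and an even hypertournament is a two-graph,
    which is represented by the graph in which [v] is isolated. *)

Set Implicit Arguments.
Unset Strict Implicit.
Unset Printing Implicit Defensive.

(** * Finite Ramsey and Hales-Jewett theorems *)

(** Induction on [a]: first a subsequence in which the colour depends only on the first element,
    then the pigeonhole principle on the first elements. *)
Lemma finite_ramsey (a b : nat) : exists p, forall (T : eqType) (c : seq T -> bool) (s : seq T),
  uniq s -> p <= size s -> exists (t : seq T) (d : bool),
  [/\ subseq t s, size t = b & forall u, subseq u t -> size u = a -> c u = d].
Proof.
elim: a b => [|a IHa] b.
  exists b => T c s _ bs; exists (take b s), (c [::]).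
  split; [exact: take_subseq | by rewrite size_take_min; apply/minn_idPl |].
  by move=> u _ /size0nil->.
(* Greedy construction: the case [a] applied to [u |-> c (x :: u)] on the tail leaves [p] elements
   on which the colours with head [x] agree, and the construction continues inside them. *)
have endh m : exists p, forall (T : eqType) (c : seq T -> bool) (s : seq T),
  uniq s -> p <= size s -> exists (t : seq T) (d : T -> bool),
  [/\ subseq t s, size t = m &
      forall x u, subseq (x :: u) t -> size u = a -> c (x :: u) = d x].
  elim: m => [|m [p IHm]].
    by exists 0 => T c s _ _; exists [::], xpredT; rewrite sub0seq.
  have [q qP] := IHa p; exists q.+1 => T c [//|x s] /= /andP[xs us] qs.
  have [t [d [ts szt td]]] := qP T (fun u => c (x :: u)) s us qs.
  have [|t' [d' [t't szt' t'd]]] := IHm T c t (subseq_uniq ts us); first by rewrite szt.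
  exists (x :: t'), (fun y => if y == x then d else d' y).
  rewrite /= eqxx szt'; split=> // [|y u]; first exact: subseq_trans ts.
  case: eqVneq => [-> ut szu|_]; last exact: t'd.
  by rewrite td //; apply: subseq_trans ut t't.
(* With [b + b] heads and two colours, one colour occurs at least [b] times. *)
have [p pP] := endh (b + b); exists p => T c s us ps.
have [t [d [ts szt td]]] := pP T c s us ps.
have [e be] : exists e, b <= count (fun x => d x == e) t.
  have := count_predC (fun x => d x == true) t; rewrite szt => cE.
  have [h|h] := leqP b (count (fun x => d x == true) t); first by exists true.
  exists false; rewrite -(@eq_count _ (predC (fun x => d x == true))); first by lia.
  by move=> x /=; case: (d x).
exists (take b [seq x <- t | d x == e]), e; split.
- exact: subseq_trans (take_subseq _ _) (subseq_trans (filter_subseq _ _) ts).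
- by rewrite size_take_min size_filter; apply/minn_idPl.
- case=> [//|x u] ut [szu].
  have ut' := subseq_trans ut (take_subseq _ _).
  rewrite (td _ _ (subseq_trans ut' (filter_subseq _ _)) szu).
  by have := mem_subseq ut' (mem_head x u); rewrite mem_filter => /andP[/eqP].
Qed.

Section HalesJewett.
Variable T : finType.
Implicit Types (w s : seq T) (L : seq (option T)).

(* A combinatorial line is a word over [option T], [None] being the moving letter. *)
Definition line_word L (x : T) : seq T := [seq odflt x o | o <- L].

Definition block_word (Ls : seq (seq (option T))) w : seq T :=
  flatten [seq line_word Lx.1 Lx.2 | Lx <- zip Ls w].

(** Pigeonhole on the [#|K| + 1] words made of [j] letters [x] and then [#|K| - j] letters [y]: two
    of them agree under [f], and the positions where they differ become the moving ones. *)
Lemma line_insensitive (x y : T) (K : finType) (f : seq T -> K) :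
  exists L, [/\ size L = #|K|, None \in L & f (line_word L x) = f (line_word L y)].
Proof.
pose u (j : 'I_#|K|.+1) := nseq j x ++ nseq (#|K| - j) y.
have /injectivePn[i [j ij fij]] : ~~ injectiveb (f \o u).
  apply/negP => /injectiveP/leq_card; rewrite card_ord; lia.
wlog lt_ij : i j ij fij / i < j.
  have /orP[h|h] : (i < j) || (j < i) by move: ij; rewrite -val_eqE /=; lia.
    by move/(_ i j ij fij h).
  by move/(_ j i); rewrite eq_sym h; apply.
have jK := ltn_ord j.
exists (nseq i (Some x) ++ nseq (j - i) None ++ nseq (#|K| - j) (Some y)); split.
- rewrite !size_cat !size_nseq; lia.
- by rewrite !mem_cat !mem_nseq eqxx subn_gt0 lt_ij !orbT.
- have -> : line_word (nseq i (Some x) ++ nseq (j - i) None ++ nseq (#|K| - j) (Some y)) x = u j.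
    by rewrite /line_word !map_cat !map_nseq /= catA -nseqD subnKC // ltnW.
  have -> // : line_word (nseq i (Some x) ++ nseq (j - i) None ++ nseq (#|K| - j) (Some y)) y = u i.
  rewrite /line_word !map_cat !map_nseq /= -nseqD /u; congr (_ ++ nseq _ _).
  by rewrite addnC addnBA ?(ltnW lt_ij) // subnK.
Qed.

Definition collapse (x y z : T) := if z == x then y else z.

(** Shelah's cube lemma. The length [N] of the later blocks is fixed first. Colouring by functions
    then allows the first line to serve all continuations of length [N] at once, and the later lines
    to serve all letters of the first block at once. *)
Lemma cube_insensitive (x y : T) n (K : finType) : exists N, forall f : seq T -> K,
  exists Ls : seq (seq (option T)),
  [/\ size Ls = n, size (flatten Ls) = N, all (fun L => None \in L) Ls &
      forall w, size w = n -> f (block_word Ls w) = f (block_word Ls (map (collapse x y) w))].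
Proof.
elim: n K => [|n IHn] K.
  by exists 0 => f; exists [::]; split=> // -[].
have [N NP] := IHn {ffun T -> K}.
exists (#|{ffun N.-tuple T -> K}| + N) => f.
have [L [szL NL fL]] := line_insensitive x y
  (fun u => [ffun v : N.-tuple T => f (u ++ v)]).
have [Ls [szLs szfL NLs fLs]] := NP (fun v => [ffun z => f (line_word L z ++ v)]).
exists (L :: Ls); split; rewrite /= ?szLs ?size_cat ?szL ?szfL ?NL //.
case=> [//|z w] [szw]; rewrite /block_word /= -!/(block_word _ _).
have /ffunP/(_ z) := fLs w szw; rewrite !ffunE => ->.
rewrite /collapse; case: eqP => // ->.
have sz : size (block_word Ls (map (collapse x y) w)) == N.
  rewrite -szfL /block_word !size_flatten /shape -!map_comp.
  apply/eqP; congr sumn.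
  rewrite -{2}(@unzip1_zip _ _ Ls (map (collapse x y) w)) ?size_map ?szLs ?szw //.
  by rewrite -map_comp; apply: eq_map => -[? ?] /=; rewrite size_map.
by have /ffunP/(_ (Tuple sz)) := fL; rewrite !ffunE.
Qed.

(* Shelah's proof: on a cube insensitive to exchanging two letters, one letter may be dropped. *)
Lemma hales_jewett_letters s (K : finType) : exists N, forall f : seq T -> K,
  exists L, [/\ size L = N, None \in L &
    {in s &, forall x y, f (line_word L x) = f (line_word L y)}].
Proof.
case: s => [|y s]; first by exists 1 => f; exists [:: None].
elim: s y => [|x s IHs] y.
  by exists 1 => f; exists [:: None]; split=> // x z; rewrite !inE => /eqP-> /eqP->.
have [n nP] := IHs x; have [N NP] := cube_insensitive y x n K.
exists N => f; have [Ls [szLs szfL NLs fLs]] := NP f.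
have [L [szL NL fL]] := nP (fun w => f (block_word Ls w)).
(* The induction hypothesis controls the letters of [x :: s]; [c] brings [y] among them. *)
pose c := collapse y x.
have cc z : c (c z) = c z by rewrite /c /collapse; case: (z =P y) => [_|/eqP/negbTE->//]; case: eqP.
(* Substitution of the line [L] into the cube: a fixed letter [t] becomes the word of its block at
   [c t], a moving letter becomes the whole block with its own moving letters. *)
pose M o (P : seq (option T)) := if omap c o is Some z then map some (line_word P z) else P.
pose L' := flatten [seq M oP.2 oP.1 | oP <- zip Ls L].
have wL' z : line_word L' z = block_word Ls (line_word (map (omap c) L) z).
  rewrite /L' /block_word /line_word; elim: (Ls) (L) => [|P Ps IH] [|o L0] //=.
  rewrite map_cat IH; congr (_ ++ _); rewrite /M; case: o => [t|] //=.
  by rewrite (mapK (g := odflt z)).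
(* Both words have the same image under [map c], so insensitivity gives them the same colour. *)
have kE z : f (line_word L' z) = f (block_word Ls (line_word L (c z))).
  rewrite wL' fLs ?size_map // [RHS]fLs ?size_map //; congr (f (block_word _ _)).
  rewrite /line_word -!map_comp; apply: eq_map => -[t|] //=; rewrite -/(c _) ?cc //.
exists L'; split.
- rewrite -szfL /L' !size_flatten /shape -!map_comp; congr sumn.
  rewrite -{2}(@unzip1_zip _ _ Ls L) ?szLs ?szL // -map_comp; apply: eq_map => -[P [o|]] //=.
  by rewrite /M /= !size_map.
- have /(nthP None)[i iL iN] := NL.
  apply/flattenP; exists (nth [::] Ls i).
    apply/mapP; exists (nth [::] Ls i, None) => //.
    by rewrite -iN -nth_zip ?szLs ?szL // mem_nth // size_zip szLs szL minnn -szL.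
  by apply: (allP NLs); rewrite mem_nth // szLs -szL.
- have cs z : z \in [:: y, x & s] -> c z \in x :: s.
    by rewrite !inE /c /collapse; case: (z =P y) => [_ _|_ //]; rewrite eqxx.
  by move=> z t /cs zs /cs ts; rewrite !kE; apply: fL.
Qed.

Lemma hales_jewett (K : finType) : exists N, forall f : seq T -> K,
  exists (L : seq (option T)) (k : K),
  [/\ size L = N, None \in L & forall x, f (line_word L x) = k].
Proof.
have [N NP] := hales_jewett_letters (enum T) K.
exists N => f; have [L [szL NL fL]] := NP f; exists L.
case: (pickP (mem T)) => [x0 _|T0].
  by exists (f (line_word L x0)); split=> // x; apply: fL; rewrite mem_enum.
(* Over the empty alphabet any colour will do. *)
by exists (f [::]); split=> // x; have := T0 x.
Qed.

End HalesJewett.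

(** * Ordered hypergraphs *)

(** A hyperedge is represented by the sequence of its vertices in increasing rank;
    [partite_embedding] and [edge_embedding] compare edge predicates on such sequences only. *)
Definition incr (V : Type) (r : V -> nat) (s : seq V) := sorted (relpre r ltn) s.

Definition increasing (U V : Type) (r : U -> nat) (q : V -> nat) (f : U -> V) :=
  {homo f : x y / r x < r y >-> q x < q y}.

Lemma incr_map (U V : Type) (r : U -> nat) (q : V -> nat) (f : U -> V) s :
  increasing r q f -> incr r s -> incr q (map f s).
Proof. by move=> fi; apply: homo_sorted => x y /fi. Qed.

Lemma increasing_mono (U V : Type) (r : U -> nat) (q : V -> nat) (f : U -> V) :
  injective r -> increasing r q f -> {mono f : x y / r x < r y >-> q x < q y}.
Proof.
move=> ri fi x y; case: (ltngtP (r x) (r y)) => [/fi->//|/fi h|/ri->]; last by rewrite ltnn.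
by apply/negbTE; rewrite -leqNgt ltnW.
Qed.

Lemma increasing_inj (U V : Type) (r : U -> nat) (q : V -> nat) (f : U -> V) :
  injective r -> increasing r q f -> injective f.
Proof.
move=> ri fi x y fxy; apply: ri.
by case: (ltngtP (r x) (r y)) => // /fi; rewrite fxy ltnn.
Qed.

(** * The partite construction *)

Section PartiteConstruction.
Variables (k p : nat) (A : finType) (rA : A -> nat) (EA : pred (seq A)).
Hypothesis rA_inj : injective rA.

Local Notation part pi := (fun v => nat_of_ord (pi v)).

(* [pi] assigns to every vertex its part; [E] tells which [k]-sequences that are
   increasing with respect to [pi] are edges. *)
Definition partite_copy (V : finType) (pi : V -> 'I_p) (E : pred (seq V))
    (al : {ffun A -> 'I_p}) (g : {ffun A -> V}) :=
  [forall x, pi (g x) == al x] &&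
  [forall s : k.-tuple A, incr rA s ==> (E (map g s) == EA s)].

Definition partite_embedding (V W : finType) (pi : V -> 'I_p) (E : pred (seq V))
    (qi : W -> 'I_p) (F : pred (seq W)) (f : V -> W) :=
  (forall v, qi (f v) = pi v) /\
  (forall X, size X = k -> incr (part pi) X -> F (map f X) = E X).

Section Step.
Variables (V : finType) (pi : V -> 'I_p) (E : pred (seq V)).
Variable al : {ffun A -> 'I_p}.
Hypothesis al_incr : increasing rA (@nat_of_ord p) al.
Variable N : nat.

(** The first component is the part; [None] marks an undefined coordinate, which arises when the
    part is not in the image of [al]. *)
Definition power_vertex := ('I_p * N.-tuple (option V))%type.

Definition edge_at (t : 'I_N) (X : seq power_vertex) :=
  all (fun v => isSome (tnth v.2 t)) X && E (pmap (fun v => tnth v.2 t) X).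

Definition over_edge (J : seq 'I_p) :=
  [exists s : k.-tuple A, [&& incr rA s, map al s == J & EA s]].

(* Over an edge of [A] a product edge needs an edge in every coordinate, elsewhere
   one coordinate suffices: in both cases the coordinates in which a line is
   constant have no influence on the vertices of that line. *)
Definition power_edge (X : seq power_vertex) :=
  if over_edge (map fst X) then [forall t, edge_at t X] else [exists t, edge_at t X].

Let copies := {g : {ffun A -> V} | partite_copy pi E al g}.

(** A moving letter keeps [v]; a constant letter [g] replaces [v] by the vertex of the copy [g] in
    the same part, if there is one. *)
Definition coordinate (v : V) (o : option copies) : option V :=
  if o is Some g then omap (val g) [pick x | al x == pi v] else Some v.

Definition line_vertex (L : N.-tuple (option copies)) (v : V) : power_vertex :=
  (pi v, [tuple of map (coordinate v) L]).

Let al_inj : injective al := increasing_inj rA_inj al_incr.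

Let pick_al x : [pick y | al y == al x] = Some x.
Proof. by case: pickP => [y /eqP/al_inj->|/(_ x)] //; rewrite eqxx. Qed.

(** In a constant coordinate the image of [X] is either partly undefined or the copy of a sequence
    [s] of [A] lying over the parts of [X], hence an edge exactly when [EA s]. So constant
    coordinates always give an edge when [over_edge] holds and never otherwise, while a moving
    coordinate returns [E X]. *)
Lemma line_partite_embedding (L : N.-tuple (option copies)) : None \in L ->
  partite_embedding pi E fst power_edge (line_vertex L).
Proof.
move=> NL; split=> // X szX Xi.
have moving t : tnth L t = None -> edge_at t (map (line_vertex L) X) = E X.
  move=> Lt; rewrite /edge_at all_map.
  have -> : all (preim (line_vertex L) (fun v => isSome (tnth v.2 t))) X.
    by apply/allP => v _ /=; rewrite tnth_map Lt.
  rewrite /=; congr E.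
  elim: (X) => //= v X0 IH; rewrite tnth_map Lt /=; congr (_ :: _); exact: IH.
have fixed_pmap t (g : copies) (s : seq A) : tnth L t = Some g ->
    map al s = map pi X ->
    pmap (fun v => tnth v.2 t) (map (line_vertex L) X) = map (val g) s.
  move=> Lt; elim: (X) s => [|v X0 IH] [|x s] //= [xv /IH->].
  by rewrite tnth_map Lt /= -xv pick_al.
have fst_line : map fst (map (line_vertex L) X) = map pi X.
  by rewrite -map_comp; apply: eq_map.
have copyE (g : copies) (s : k.-tuple A) : incr rA s -> E (map (val g) s) = EA s.
  by case: g => g /= /andP[_ /forallP/(_ s)/implyP h] /h/eqP.
have [t0 Lt0] : exists t, tnth L t = None by case/tnthP: NL => t ->; exists t.
rewrite /power_edge fst_line; case: ifPn => [/existsP[s /and3P[si /eqP sX sE]]|noedge].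
  apply/forallP/idP => [/(_ t0)|EX t]; first by rewrite moving.
  case Lt: (tnth L t) => [g|]; last by rewrite moving.
  rewrite /edge_at (fixed_pmap _ _ _ Lt sX) copyE // sE andbT all_map.
  apply/allP => v vX /=; rewrite tnth_map Lt /=.
  have : pi v \in map al s by rewrite sX map_f.
  by case/mapP => x _ ->; rewrite pick_al.
apply/existsP/idP => [[t]|EX]; last by exists t0; rewrite moving.
case Lt: (tnth L t) => [g|]; last by rewrite moving.
case/andP; rewrite all_map => /allP Xal Et.
(* All vertices are defined in a constant coordinate, so every part of [X] is some [al x]. *)
have [s sX] : exists s, map al s = map pi X.
  elim: (X) Xal => [|v X0 IH] Xal; first by exists [::].
  have [|s sX] := IH; first by move=> u uX; apply: Xal; rewrite inE uX orbT.
  have := Xal v (mem_head _ _); rewrite /= tnth_map Lt /=.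
  by case: pickP => // x /eqP xv _; exists (x :: s); rewrite /= xv sX.
have szs : size s == k by rewrite -szX -(size_map pi) -sX size_map.
have si : incr rA s.
  rewrite /incr -(mono_sorted (e' := relpre (@nat_of_ord p) ltn) (f := al)); last first.
    by move=> x y; apply: (increasing_mono rA_inj al_incr).
  by rewrite sX sorted_map.
case/existsP: noedge; exists (Tuple szs); rewrite si /= sX eqxx /=.
by rewrite -(copyE g (Tuple szs)) //= -(fixed_pmap _ _ _ Lt sX).
Qed.

(** The image of the copy [g] under the line is the word of the line at the letter [g], which links
    colours of copies to colours of words. In a constant coordinate [h], the vertex [g x] becomes
    [h x] because both lie in the part [al x]. *)
Lemma line_vertex_word (L : N.-tuple (option copies)) (g : copies) x :
  line_vertex L (val g x) =
  (al x, [tuple of map (fun h : copies => Some (val h x)) [tuple of line_word L g]]).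
Proof.
have piE (h : copies) : pi (val h x) = al x.
  by case: h => h /= /andP[/forallP/(_ x)/eqP].
congr pair; first exact: piE.
apply: val_inj; rewrite /= /line_word -map_comp; apply: eq_map => -[h|] //=.
by rewrite piE pick_al.
Qed.

End Step.

Lemma partite_step (V : finType) (pi : V -> 'I_p) (E : pred (seq V)) (al : {ffun A -> 'I_p}) :
  increasing rA (@nat_of_ord p) al ->
  exists (W : finType) (qi : W -> 'I_p) (F : pred (seq W)),
  forall chi : {ffun A -> W} -> bool, exists (f : V -> W) (c : bool),
    partite_embedding pi E qi F f /\
    (forall g, partite_copy pi E al g -> chi [ffun x => f (g x)] = c).
Proof.
move=> al_incr; pose copies := {g : {ffun A -> V} | partite_copy pi E al g}.
have [N NP] := hales_jewett copies bool.
exists (power_vertex V N), fst, (power_edge E al (N := N)) => chi.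
(* The default of [insubd] is reached only by words of length other than [N]; the words of the line
   all have length [N]. *)
pose word_copy (w : seq copies) : {ffun A -> power_vertex V N} :=
  [ffun x => (al x, insubd [tuple of nseq N None] (map (fun h : copies => Some (val h x)) w))].
have [L [c [szL NL Lc]]] := NP (chi \o word_copy).
pose L' : N.-tuple (option copies) := Tuple (introT eqP szL).
exists (line_vertex L'), c; split; first exact: line_partite_embedding.
move=> g gc; rewrite -(Lc (exist _ g gc)) /=; congr chi; apply/ffunP => x; rewrite !ffunE.
have /= -> := line_vertex_word al_incr L' (exist _ g gc) x.
by congr pair; apply: val_inj; rewrite val_insubd /= !size_map szL eqxx.
Qed.

(** The system [V1] treats [al], and [V2] is built over it for the other placements. Given a
    colouring, [f2] is chosen first and [f1] then for the colouring pulled back to [V1]; since [f1]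
    preserves copies and their placements, what [f2] achieved is kept. *)
Lemma partite_iteration (V : finType) (pi : V -> 'I_p) (E : pred (seq V))
    (l : seq {ffun A -> 'I_p}) :
  (forall al, al \in l -> increasing rA (@nat_of_ord p) al) ->
  exists (W : finType) (qi : W -> 'I_p) (F : pred (seq W)),
  forall chi : {ffun A -> W} -> bool, exists (f : V -> W) (c : {ffun A -> 'I_p} -> bool),
    partite_embedding pi E qi F f /\
    (forall al g, al \in l -> partite_copy pi E al g -> chi [ffun x => f (g x)] = c al).
Proof.
elim: l V pi E => [|al l IHl] V pi E li.
  by exists V, pi, E => chi; exists id, xpredT; split=> //; split=> // X; rewrite map_id.
have [V1 [pi1 [E1 h1]]] := partite_step pi E (li al (mem_head _ _)).
have [|V2 [pi2 [E2 h2]]] := IHl V1 pi1 E1.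
  by move=> be bl; apply: li; rewrite inE bl orbT.
exists V2, pi2, E2 => chi; have [f2 [c2 [[f2pi f2E] f2c]]] := h2 chi.
have [f1 [c1 [[f1pi f1E] f1c]]] := h1 (fun g => chi [ffun x => f2 (g x)]).
have comp (g : {ffun A -> V}) : [ffun x => (f2 \o f1) (g x)] =
    [ffun x => f2 ([ffun y => f1 (g y)] x)] by apply/ffunP => x; rewrite !ffunE.
have f1i X : incr (part pi) X -> incr (part pi1) (map f1 X).
  by apply: incr_map => u v; rewrite !f1pi.
exists (f2 \o f1), (fun be => if be == al then c1 else c2 be); split.
  split=> [v|X szX Xi]; first by rewrite /= f2pi f1pi.
  by rewrite map_comp f2E ?size_map ?f1E //; apply: f1i.
move=> be g; rewrite inE comp; case: eqVneq => [-> _ gc|_ /= bl /andP[/forallP gpi /forallP gE]].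
  exact: f1c.
apply: f2c => //; apply/andP; split; [apply/forallP => x | apply/forallP => s].
  by rewrite ffunE f1pi.
apply/implyP => si; rewrite -(eqP (implyP (gE s) si)).
have -> : map [ffun x => f1 (g x)] s = map f1 (map g s).
  by rewrite -map_comp; apply: eq_map => x; rewrite ffunE.
rewrite f1E ?size_map ?size_tuple //.
apply: incr_map si => x y xy; rewrite !(eqP (gpi _)).
by apply: li xy; rewrite inE bl orbT.
Qed.

End PartiteConstruction.

(** * The Ramsey property of ordered uniform hypergraphs *)

Definition edge_embedding k (A B : Type) (rA : A -> nat) (EA : pred (seq A))
    (rB : B -> nat) (EB : pred (seq B)) (f : A -> B) :=
  increasing rA rB f /\
  (forall s, size s = k -> incr rA s -> EB (map f s) = EA s).

Theorem ordered_hypergraph_ramsey k (A B : finType) (rA : A -> nat) (EA : pred (seq A))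
    (rB : B -> nat) (EB : pred (seq B)) : injective rA -> injective rB ->
  exists (C : finType) (rC : C -> nat) (EC : pred (seq C)), injective rC /\
  forall chi : {ffun A -> C} -> bool, exists f : {ffun B -> C},
    edge_embedding k rB EB rC EC f /\
    exists c, forall g : {ffun A -> B},
      edge_embedding k rA EA rB EB g -> chi [ffun x => f (g x)] = c.
Proof.
move=> rA_inj rB_inj.
have [p pP] := finite_ramsey #|A| #|B|.
(* There are [p.+1] parts rather than [p], so that [ord0] exists as a default for [nth]. *)
pose l := [seq al : {ffun A -> 'I_p.+1} <- enum {ffun A -> 'I_p.+1} |
   [forall x, forall y, (rA x < rA y) ==> (al x < al y)]].
have lP (al : {ffun A -> 'I_p.+1}) : reflect (increasing rA (@nat_of_ord p.+1) al) (al \in l).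
  rewrite mem_filter mem_enum andbT; apply: (iffP forallP) => h x.
    by move=> y; apply/implyP; have /forallP := h x; apply.
  by apply/forallP => y; apply/implyP; apply: h.
(* Edges ignore the part, so [i |-> (be i, i)] is a copy of [B] for every increasing placement [be]
   in the parts. *)
pose pi (v : 'I_p.+1 * B) := v.1; pose E (X : seq ('I_p.+1 * B)) := EB (map snd X).
have [|C [qi [EC h]]] := @partite_iteration k p.+1 A rA EA rA_inj _ pi E l.
  by move=> al /lP.
(* Lexicographic order: the part decides first, and [enum_rank v < #|C|] breaks ties. *)
pose rC v := qi v * #|C| + enum_rank v.
have rC_lt u v : qi u < qi v -> rC u < rC v.
  move=> quv; apply: leq_trans (leq_addr _ _).
  have : (qi u).+1 * #|C| <= qi v * #|C| by rewrite leq_mul2r quv orbT.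
  by apply: leq_trans; rewrite mulSn /rC addnC ltn_add2r.
exists C, rC, EC; split.
  move=> u v; case: (ltngtP (qi u) (qi v)) => [/rC_lt|/rC_lt|]; try lia.
  by move=> e /eqP; rewrite /rC e eqn_add2l => /eqP/val_inj/enum_rank_inj.
move=> chi; have [f [c [[fpi fE] fc]]] := h chi.
pose eA := sort (relpre rA leq) (enum A); pose eB := sort (relpre rB leq) (enum B).
have sortedE (T : finType) (r : T -> nat) : injective r ->
    incr r (sort (relpre r leq) (enum T)).
  move=> ri; rewrite /incr -sorted_map ltn_sorted_uniq_leq map_inj_uniq // sort_uniq enum_uniq.
  by rewrite sorted_map; apply: sort_sorted => x y; apply: leq_total.
have index_incr (T : finType) (r : T -> nat) : injective r ->
    increasing r id (fun x => index x (sort (relpre r leq) (enum T))).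
  move=> ri x y xy; have mem_sorted z : z \in sort (relpre r leq) (enum T).
    by rewrite mem_sort mem_enum.
  case: ltngtP => // [|/index_inj e]; last by rewrite e ?ltnn in xy.
  have tr : transitive (relpre r ltn) by move=> a b e; apply: ltn_trans.
  by move/(sorted_ltn_index tr (sortedE T r ri))=> /(_ (mem_sorted y) (mem_sorted x)) /=; lia.
have szeA : size eA = #|A| by rewrite size_sort -cardE.
have szeB : size eB = #|B| by rewrite size_sort -cardE.
have mem_eA x : x \in eA by rewrite mem_sort mem_enum.
have mem_eB x : x \in eB by rewrite mem_sort mem_enum.
(* A sequence of [#|A|] parts is read as a placement of [A] along the increasing enumeration [eA];
   [t] consists of [#|B|] parts on which the colour of placements is constant. *)
have [||t [d [tp szt td]]] := pP _ (fun u : seq 'I_p.+1 => c [ffun x => nth ord0 u (index x eA)])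
    (enum 'I_p.+1); [exact: enum_uniq | by rewrite size_enum_ord |].
pose be (i : B) := nth ord0 t (index i eB).
have be_incr : increasing rB (@nat_of_ord p.+1) be.
  have t_sorted : sorted (relpre (@nat_of_ord p.+1) ltn) t.
    apply: subseq_sorted tp _; first by move=> i j m; apply: ltn_trans.
    by rewrite -sorted_map val_enum_ord iota_ltn_sorted.
  move=> x y xy; apply: (sorted_ltn_nth _ _ t_sorted); first by move=> i j m; apply: ltn_trans.
  - by rewrite inE szt -szeB index_mem.
  - by rewrite inE szt -szeB index_mem.
  - exact: index_incr.
have tE : t = map be eB.
  apply: (@eq_from_nth _ ord0) => [|i it]; first by rewrite size_map szeB.
  have ib : i < size eB by rewrite szeB -szt.
  have [x0 _] : exists x0 : B, True by case: (eB) ib => // x0; exists x0.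
  by rewrite (nth_map x0) // /be index_uniq // sort_uniq enum_uniq.
exists [ffun i => f (be i, i)]; split.
  split=> [x y xy|s szs si]; first by rewrite !ffunE; apply: rC_lt; rewrite !fpi; apply: be_incr.
  have -> : map [ffun i => f (be i, i)] s = map f (map (fun i => (be i, i)) s).
    by rewrite -map_comp; apply: eq_map => x; rewrite ffunE.
  rewrite fE ?size_map ?/E -?map_comp ?map_id //.
  by apply: incr_map si => x y /be_incr.
exists d => g [gi gE].
pose al := [ffun x => be (g x)].
have al_incr : increasing rA (@nat_of_ord p.+1) al.
  by move=> x y /gi/be_incr; rewrite !ffunE.
pose g' : {ffun A -> 'I_p.+1 * B} := [ffun x => (be (g x), g x)].
have -> : [ffun x => [ffun i => f (be i, i)] (g x)] = [ffun x => f (g' x)].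
  by apply/ffunP => x; rewrite !ffunE.
rewrite (fc al) ?(introT (lP _)) //; last first.
  apply/andP; split; [apply/forallP => x | apply/forallP => s]; first by rewrite !ffunE.
  apply/implyP => si; rewrite -gE ?size_tuple // /E -map_comp; apply/eqP; congr EB.
  by apply: eq_map => x; rewrite /= ffunE.
have -> : al = [ffun x => nth ord0 (map be (map g eA)) (index x eA)].
  apply/ffunP => x; rewrite !ffunE -map_comp (nth_map x) ?index_mem // nth_index //.
apply: td; last by rewrite !size_map.
rewrite tE; apply: map_subseq.
(* Both sides are increasing with the same members; a filter of [eB] is a subsequence, so the
   placement of [A] is a subsequence of [t]. *)
have -> : map g eA = [seq y <- eB | y \in map g eA].
  have tr : transitive (relpre rB ltn) by move=> i j m; apply: ltn_trans.
  apply: (irr_sorted_eq tr) => [x /=||| y].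
  - exact: ltnn.
  - by apply: incr_map gi _; apply: sortedE.
  - by apply: sorted_filter => //; apply: sortedE.
  - by rewrite mem_filter mem_eB andbT.
exact: filter_subseq.
Qed.

(** * Transfer to hypertournaments *)

Lemma linear_order_rank (T : finType) (le : rel T) : linear_order le ->
  exists2 r : T -> nat, injective r & forall x y, le x y = (r x <= r y).
Proof.
case=> lexx le_anti le_trans le_total.
pose s := sort le (enum T).
have mem_s x : x \in s by rewrite mem_sort mem_enum.
have le_s : sorted le s by apply: sort_sorted.
have index_le x y : index x s <= index y s -> le x y.
  by move=> h; apply: (sorted_leq_index le_trans lexx le_s).
have index_injs : injective (index^~ s) by move=> x y; apply: index_inj.
exists (index^~ s) => // x y; apply/idP/idP => [xy|/index_le//].
case: leqP => // yx; have yx' := index_le _ _ (ltnW yx).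
by rewrite (le_anti x y) ?xy // ltnn in yx.
Qed.

Lemma rank_linear_order (T : Type) (r : T -> nat) :
  injective r -> linear_order (fun x y => r x <= r y).
Proof.
move=> ri; split.
- by move=> x; apply: leqnn.
- by move=> x y; rewrite -eqn_leq => /eqP/ri.
- by move=> y x z; apply: leq_trans.
- by move=> x y; apply: leq_total.
Qed.

Lemma strict_rank (T : eqType) (le : rel T) (r : T -> nat) x y :
  injective r -> (forall x y, le x y = (r x <= r y)) -> strict le x y = (r x < r y).
Proof. by move=> ri leE; rewrite /strict leE ltn_neqAle (inj_eq ri). Qed.

Lemma rank_increasing (U V : Type) (leU : rel U) (leV : rel V) (r : U -> nat) (q : V -> nat)
    (f : U -> V) : (forall x y, leU x y = (r x <= r y)) -> (forall x y, leV x y = (q x <= q y)) ->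
  {mono f : x y / leU x y >-> leV x y} -> increasing r q f.
Proof. by move=> leUE leVE fm x y; rewrite !ltnNge -leUE -leVE fm. Qed.

(** Transfer principle: it suffices that embeddings in [K] preserve an order and a predicate on
    [k]-sequences, that every ordered [k]-uniform hypergraph yields a member of [K], and that
    hypergraph embeddings of members of [K] into it are embeddings of structures. *)
Lemma ramsey_of_ordered_edges (L : language) (K : class L) (k : nat)
    (le : forall A : structure L, A -> A -> bool) (E : forall A : structure L, pred (seq A)) :
  (forall A, K A -> linear_order (@le A)) ->
  (forall (A B : structure L) (f : {ffun A -> B}), K A -> K B -> is_embedding f ->
     {mono f : x y / @le A x y >-> @le B x y} /\
     forall s, size s = k -> E B (map f s) = E A s) ->
  (forall (V : finType) (r : V -> nat) (EV : pred (seq V)), injective r ->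
     exists i : forall s : L, pred ((arity s).-tuple V), K (Structure i) /\
     forall (B : structure L) (rB : B -> nat) (f : {ffun B -> V}), K B -> injective rB ->
       (forall x y, @le B x y = (rB x <= rB y)) ->
       edge_embedding k rB (E B) r EV f -> @is_embedding L B (Structure i) f) ->
  ramsey K.
Proof.
move=> K_le K_emb K_mk A B KA KB.
have [rA rA_inj rAE] := linear_order_rank (K_le A KA).
have [rB rB_inj rBE] := linear_order_rank (K_le B KB).
have [V [r [EV [r_inj VP]]]] := ordered_hypergraph_ramsey k (E A) (E B) rA_inj rB_inj.
have [i [KC CP]] := K_mk V r EV r_inj; pose C := Structure i.
exists C => // chi.
(* Maps that are not embeddings get the dummy colour [false]; the maps compared at the end are all
   embeddings. *)
have [f [fe [c fc]]] := VP (fun g => if insub g is Some e then chi (e : embedding A C) else false).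
pose F : embedding B C := exist _ f (CP B rB f KB rB_inj rBE fe).
exists F; suff chiE g : chi (comp_embedding F g) = c by move=> g h; rewrite !chiE.
have [g_mono gE] := K_emb A B (val g) KA KB (valP g).
rewrite -(fc (val g)); last by split=> [|s /gE//]; apply: rank_increasing g_mono.
by have -> : [ffun x => f (val g x)] = val (comp_embedding F g) by []; rewrite valK.
Qed.

Lemma ordered_embeddingP (A B : structure (language_add ht_language order_language))
    (f : {ffun A -> B}) :
  is_embedding f <->
  [/\ injective f,
      forall x y z, @htR (reduct B) (f x) (f y) (f z) = @htR (reduct A) x y z &
      {mono f : x y / @leR A x y >-> @leR B x y}].
Proof.
split=> [/andP[/injectiveP fi /forallP fE]|[fi fR fle]].
  split=> // [x y z|x y].
    have /eqP := forallP (fE (inl tt)) [tuple x; y; z]; rewrite /htR /= => <-.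
    by congr (interp _); apply: val_inj.
  have /eqP := forallP (fE (inr tt)) [tuple x; y]; rewrite /leR /= => <-.
  by congr (interp _); apply: val_inj.
apply/andP; split; first exact/injectiveP.
apply/forallP => -[[]|[]]; apply/forallP => -[[|x [|y [|z []]]] // st].
  apply/eqP; have := fR x y z; rewrite /htR /=.
  by congr (_ = _); congr (interp _); apply: val_inj.
apply/eqP; have := fle x y; rewrite /leR /=.
by congr (_ = _); congr (interp _); apply: val_inj.
Qed.

Lemma even_embeddingP (A B : structure (language_add ht_language order_graph_language))
    (f : {ffun A -> B}) :
  is_embedding f <->
  [/\ injective f,
      forall x y z, @htR (reduct B) (f x) (f y) (f z) = @htR (reduct A) x y z,
      {mono f : x y / @ogLe A x y >-> @ogLe B x y} &
      {mono f : x y / @ogE A x y >-> @ogE B x y}].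
Proof.
split=> [/andP[/injectiveP fi /forallP fE]|[fi fR fle fG]].
  split=> // [x y z|x y|x y].
  - have /eqP := forallP (fE (inl tt)) [tuple x; y; z]; rewrite /htR /= => <-.
    by congr (interp _); apply: val_inj.
  - have /eqP := forallP (fE (inr (inl tt))) [tuple x; y]; rewrite /ogLe /= => <-.
    by congr (interp _); apply: val_inj.
  - have /eqP := forallP (fE (inr (inr tt))) [tuple x; y]; rewrite /ogE /= => <-.
    by congr (interp _); apply: val_inj.
apply/andP; split; first exact/injectiveP.
apply/forallP => -[[]|[[]|[]]]; apply/forallP => -[[|x [|y [|z []]]] // st]; apply/eqP.
- have := fR x y z; rewrite /htR /=.
  by congr (_ = _); congr (interp _); apply: val_inj.
- have := fle x y; rewrite /ogLe /=.
  by congr (_ = _); congr (interp _); apply: val_inj.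
- have := fG x y; rewrite /ogE /=.
  by congr (_ = _); congr (interp _); apply: val_inj.
Qed.

(** * Hypertournaments determined by their increasing triples *)

Section Orientation.
Variables (V : eqType) (r : V -> nat) (t : V -> V -> V -> bool).
Hypothesis r_inj : injective r.

Definition oriented x y z := [&& r x < r y, r y < r z & t x y z].
Definition unoriented x y z := [&& r x < r y, r y < r z & ~~ t x y z].

(* The hypertournament in which [t] selects the triples oriented along the rank. *)
Definition orient x y z :=
  [|| oriented x y z, oriented y z x, oriented z x y,
      unoriented x z y, unoriented z y x | unoriented y x z].

Lemma orient_uniq x y z : orient x y z -> uniq [:: x; y; z].
Proof.
rewrite /orient /oriented /unoriented /= !inE -!(inj_eq r_inj); lia.
Qed.

Lemma orient_rot x y z : orient x y z = orient y z x.
Proof.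
rewrite /orient; case: (oriented x y z); case: (oriented y z x); case: (oriented z x y) => //=.
by case: (unoriented x z y); case: (unoriented z y x); case: (unoriented y x z).
Qed.

Lemma orient_alt x y z : uniq [:: x; y; z] -> orient x z y = ~~ orient x y z.
Proof.
rewrite /orient /oriented /unoriented /= !inE -!(inj_eq r_inj).
case: (ltngtP (r x) (r y)) => //; case: (ltngtP (r y) (r z)) => //;
  case: (ltngtP (r x) (r z)) => //=; rewrite ?andbF ?orbF ?negbK //; lia.
Qed.

Lemma orient_incr x y z : r x < r y -> r y < r z -> orient x y z = t x y z.
Proof.
move=> xy yz; rewrite /orient /oriented /unoriented xy yz /=.
have -> : (r z < r x) = false by lia.
have -> : (r z < r y) = false by lia.
have -> : (r y < r x) = false by lia.
by rewrite /= !andbF !orbF.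
Qed.

End Orientation.

Lemma orient_map (U V : eqType) (r : U -> nat) (q : V -> nat) t t' (f : U -> V) :
  injective r -> increasing r q f ->
  (forall x y z, r x < r y -> r y < r z -> t' (f x) (f y) (f z) = t x y z) ->
  forall x y z, orient q t' (f x) (f y) (f z) = orient r t x y z.
Proof.
move=> ri fi tE.
have oE x y z : oriented q t' (f x) (f y) (f z) = oriented r t x y z.
  rewrite /oriented !(increasing_mono ri fi).
  by case: (ltnP (r x) (r y)) => //= xy; case: (ltnP (r y) (r z)) => //= yz; rewrite tE.
have uE x y z : unoriented q t' (f x) (f y) (f z) = unoriented r t x y z.
  rewrite /unoriented !(increasing_mono ri fi).
  by case: (ltnP (r x) (r y)) => //= xy; case: (ltnP (r y) (r z)) => //= yz; rewrite tE.
by move=> x y z; rewrite /orient !oE !uE.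
Qed.

(** Rotation and alternation carry the values on increasing triples to all triples, so an ordered
    hypertournament is the same as its 3-uniform hypergraph. *)
Lemma hypertournament_orient (A : structure ht_language) (r : A -> nat) :
  injective r -> is_hypertournament A -> forall x y z, htR x y z = orient r (@htR A) x y z.
Proof.
move=> ri /hypertournamentP[Ru Rr Ra] x y z.
have [U|N] := boolP (uniq [:: x; y; z]); last first.
  by apply/idP/idP => [/Ru|/(orient_uniq ri)]; rewrite (negbTE N).
move: (U); rewrite /orient /oriented /unoriented /= !inE -!(inj_eq ri).
have a1 := Ra _ _ _ U; have r1 := Rr x y z; have r2 := Rr y z x.
have r3 := Rr x z y; have r4 := Rr z y x.
case: (ltngtP (r x) (r y)) => //; case: (ltngtP (r y) (r z)) => //;
  case: (ltngtP (r x) (r z)) => //=; rewrite ?andbF ?orbF //; lia.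
Qed.

Lemma hypertournament_mono (A B : structure ht_language) (rA : A -> nat) (rB : B -> nat)
    (f : A -> B) :
  is_hypertournament A -> is_hypertournament B -> injective rA -> injective rB ->
  increasing rA rB f ->
  (forall x y z, rA x < rA y -> rA y < rA z -> htR (f x) (f y) (f z) = htR x y z) ->
  forall x y z, htR (f x) (f y) (f z) = htR x y z.
Proof.
move=> HA HB iA iB fi fE x y z.
rewrite (hypertournament_orient iB HB) (hypertournament_orient iA HA).
exact: orient_map.
Qed.

(** * The Ramsey property of the three ordered classes *)

Definition pair_interp (V : Type) (e : V -> V -> bool) (u : 2.-tuple V) :=
  if val u is [:: x; y] then e x y else false.

Definition triple_interp (V : Type) (e : V -> V -> V -> bool) (u : 3.-tuple V) :=
  if val u is [:: x; y; z] then e x y z else false.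

Definition ht_interp (V : finType) (r : V -> nat) t (s : ht_language) :
    pred ((arity s).-tuple V) := triple_interp (orient r t).

Lemma ht_interp_hypertournament (V : finType) (r : V -> nat) t :
  injective r -> is_hypertournament (Structure (ht_interp r t)).
Proof.
move=> ri; apply/hypertournamentP; split.
- exact: orient_uniq.
- exact: orient_rot.
- exact: orient_alt.
Qed.

Definition ordered_ht_interp (V : finType) (r : V -> nat) t
    (s : language_add ht_language order_language) : pred ((arity s).-tuple V) :=
  match s with
  | inl s => ht_interp r t (s := s)
  | inr s => pair_interp (fun x y => r x <= r y)
  end.

Lemma ramsey_ordered_hypertournaments : ramsey ordered_hypertournaments.
Proof.
apply: (@ramsey_of_ordered_edges _ _ 3 leR
  (fun A s => if s is [:: x; y; z] then @htR (reduct A) x y z else false)).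
- by move=> A [].
- move=> A B f _ _ /ordered_embeddingP[_ fR fle]; split=> // -[|x [|y [|z []]]] //= _; exact: fR.
- move=> V r EV ri; exists (ordered_ht_interp r (fun x y z => EV [:: x; y; z])); split.
    by split; [exact: ht_interp_hypertournament | exact: rank_linear_order].
  move=> B rB f [HB _] iB leE [fi fE]; apply/ordered_embeddingP; split.
  + exact: increasing_inj fi.
  + apply: (hypertournament_mono HB (ht_interp_hypertournament _ ri) iB ri fi) => x y z xy yz.
    rewrite [LHS](orient_incr _ (fi _ _ xy) (fi _ _ yz)).
    by rewrite (fE [:: x; y; z]) //= /incr /= xy yz.
  + by move=> x y; rewrite leE [LHS]leqNgt (increasing_mono iB fi) -leqNgt.
Qed.

(** The order determines the whole structure, so a hypergraph without edges suffices, with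
    [k = 0]. *)
Lemma ramsey_ordered_cyclic : ramsey ordered_cyclic.
Proof.
apply: (@ramsey_of_ordered_edges _ _ 0 leR (fun A s => false)).
- by move=> A [].
- by move=> A B f _ _ /ordered_embeddingP[_ fR fle].
- move=> V r EV ri; exists (ordered_ht_interp r (fun x y z => true)); split.
    split; [exact: ht_interp_hypertournament | exact: rank_linear_order |].
    move=> x y z; rewrite !(strict_rank (r := r)) // => xy yz.
    by have := orient_incr (fun _ _ _ => true) xy yz.
  move=> B rB f [HB _ Bc] iB leE [fi fE]; apply/ordered_embeddingP; split.
  + exact: increasing_inj fi.
  + apply: (hypertournament_mono HB (ht_interp_hypertournament _ ri) iB ri fi) => x y z xy yz.
    rewrite [LHS](orient_incr _ (fi _ _ xy) (fi _ _ yz)) Bc //.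
      by rewrite (strict_rank _ _ iB leE).
    by rewrite (strict_rank _ _ iB leE).
  + by move=> x y; rewrite leE [LHS]leqNgt (increasing_mono iB fi) -leqNgt.
Qed.

Definition even_triple (V : Type) (e : rel V) x y z := ~~ odd (e x y + e y z + e x z).

Definition even_ht_interp (V : finType) (r : V -> nat) (e : rel V)
    (s : language_add ht_language order_graph_language) : pred ((arity s).-tuple V) :=
  match s with
  | inl s => ht_interp r (even_triple e) (s := s)
  | inr (inl s) => pair_interp (fun x y => r x <= r y)
  | inr (inr s) => pair_interp e
  end.

Lemma even_ht_interp_even (V : finType) (r : V -> nat) (e : rel V) :
  injective r -> irreflexive e -> symmetric e -> ordered_even (Structure (even_ht_interp r e)).
Proof.
move=> ri e_irr e_sym; split=> //; [exact: rank_linear_order | exact: ht_interp_hypertournament |].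
move=> a b c; rewrite !(strict_rank (r := r)) // => ab bc /=.
have abc : orient r (even_triple e) a b c = even_triple e a b c by apply: orient_incr.
have acb := orient_alt (r := r) (even_triple e) ri (x := a) (y := b) (z := c).
split; first exact: abc.
rewrite [LHS]acb ?abc ?negbK //.
by rewrite /= !inE -!(inj_eq ri); lia.
Qed.

(** The order and the graph determine [R], so [k = 2] suffices, and every ordered graph occurs. *)
Lemma ramsey_ordered_even : ramsey ordered_even.
Proof.
apply: (@ramsey_of_ordered_edges _ _ 2 ogLe
  (fun A s => if s is [:: x; y] then @ogE A x y else false)).
- by move=> A [].
- by move=> A B f _ _ /even_embeddingP[_ fR fle fG]; split=> // -[|x [|y []]] /=.
- move=> V r EV ri.
  (* [EV] is read on increasing pairs and symmetrised to a loopless graph. *)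
  pose e x y := if r x < r y then EV [:: x; y] else if r y < r x then EV [:: y; x] else false.
  have KC : ordered_even (Structure (even_ht_interp r e)).
    apply: even_ht_interp_even => // [x|x y]; first by rewrite /e ltnn.
    by rewrite /e; case: ltngtP.
  exists (even_ht_interp r e); split=> //.
  move=> B rB f [Blin [B_irr B_sym] HB Be] iB leE [fi fE].
  have eE x y : e (f x) (f y) = ogE x y.
    rewrite /e !(increasing_mono iB fi); case: ltngtP => [xy|xy|/iB->]; last by rewrite B_irr.
      by rewrite (fE [:: x; y]) //= /incr /= xy.
    by rewrite (fE [:: y; x]) //= /incr /= xy.
  apply/even_embeddingP; split.
  + exact: increasing_inj fi.
  + have [_ _ HC _] := KC; apply: (hypertournament_mono HB HC iB ri fi) => x y z xy yz.
    rewrite [LHS](orient_incr _ (fi _ _ xy) (fi _ _ yz)) /even_triple !eE.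
    by have [] := Be x y z; rewrite ?(strict_rank _ _ iB leE).
  + by move=> x y; rewrite leE [LHS]leqNgt (increasing_mono iB fi) -leqNgt.
  + exact: eE.
Qed.

(** * Hypertournaments on four points *)

Lemma induced_hypertournament (A : structure ht_language) (X : {set A}) :
  is_hypertournament A -> is_hypertournament (induced X).
Proof.
move=> /hypertournamentP[Ru Rr Ra]; apply/hypertournamentP; split=> x y z.
- by rewrite htR_induced => /Ru; rewrite /= !inE.
- by rewrite !htR_induced Rr.
- by move=> U; rewrite !htR_induced Ra.
Qed.

Lemma card_induced (A : structure ht_language) (X : {set A}) : #|induced X| = #|X|.
Proof. by rewrite /= card_sig; apply: eq_card. Qed.

Lemma hypertournament_perms (A : structure ht_language) (x y z : A) :
  is_hypertournament A -> uniq [:: x; y; z] ->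
  ((htR y z x = htR x y z) * (htR z x y = htR x y z) * (htR x z y = ~~ htR x y z) *
   (htR z y x = ~~ htR x y z) * (htR y x z = ~~ htR x y z))%type.
Proof.
move=> /hypertournamentP[_ Rr Ra] U; have a := Ra _ _ _ U.
by do !split; rewrite // ?[htR z y x]Rr ?[htR y x z]Rr -?a // ?[htR x y z]Rr // [htR y z x]Rr.
Qed.

Lemma incr_enum (T : finType) (r : T -> nat) (X : {set T}) : injective r ->
  exists s, [/\ incr r s, s =i X & size s = #|X|].
Proof.
move=> ri; exists (sort (relpre r leq) (enum X)); split.
- rewrite /incr -sorted_map ltn_sorted_uniq_leq map_inj_uniq // sort_uniq enum_uniq.
  by rewrite sorted_map; apply: sort_sorted => x y; apply: leq_total.
- by move=> x; rewrite mem_sort mem_enum.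
- by rewrite size_sort cardE.
Qed.

Lemma incr_triple (T : finType) (r : T -> nat) (X : {set T}) : injective r -> #|X| = 3 ->
  exists a b c, [/\ r a < r b, r b < r c & X = [set a; b; c]].
Proof.
move=> ri X3; have [s [+ sX +]] := incr_enum X ri; rewrite X3.
case: s sX => [|a [|b [|c []]]] //= sX; rewrite /incr /= => /and3P[ab bc _] _.
by exists a, b, c; split=> //; apply/setP => x; rewrite -sX !inE orbA.
Qed.

Lemma incr_quadruple (T : finType) (r : T -> nat) : injective r -> #|T| = 4 ->
  exists a b c d, [/\ r a < r b, r b < r c, r c < r d & forall x, x \in [:: a; b; c; d]].
Proof.
move=> ri T4; have [s [+ sT +]] := incr_enum [set: T] ri; rewrite cardsT T4.
case: s sT => [|a [|b [|c [|d []]]]] //= sT; rewrite /incr /= => /and4P[ab bc cd _] _.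
by exists a, b, c, d; split=> // x; rewrite sT inE.
Qed.

Section Hyperedges.
Variables (A : structure ht_language) (le : rel A) (r : A -> nat).
Hypotheses (r_inj : injective r) (leE : forall x y, le x y = (r x <= r y)).

Lemma hyperedgesP X : reflect
  (exists a b c, [/\ X = [set a; b; c], r a < r b, r b < r c & htR a b c]) (X \in hyperedges le).
Proof.
rewrite inE; apply: (iffP existsP) => [[a /existsP[b /existsP[c /and4P[/eqP-> ab bc abc]]]]|].
  by exists a, b, c; move: ab bc; rewrite !(strict_rank _ _ r_inj leE).
move=> [a [b [c [-> ab bc abc]]]]; exists a; apply/existsP; exists b; apply/existsP; exists c.
by rewrite eqxx !(strict_rank _ _ r_inj leE) ab bc abc.
Qed.

Lemma mem_hyperedges a b c : r a < r b -> r b < r c ->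
  ([set a; b; c] \in hyperedges le) = htR a b c.
Proof.
move=> ab bc; apply/hyperedgesP/idP => [[a' [b' [c' [e ab' bc' h]]]]|abc]; last by exists a, b, c.
have /setP E := esym e.
move: h ab' bc'.
have := E a'; have := E b'; have := E c'; rewrite !inE !eqxx ?orbT /=.
case/esym/orP => [/orP[]|] /eqP->; case/esym/orP => [/orP[]|] /eqP->;
 case/esym/orP => [/orP[]|] /eqP-> => //; lia.
Qed.

End Hyperedges.

Section FourPoints.
Variable A : structure ht_language.
Hypothesis htA : is_hypertournament A.
(** Statements about [C4] become arithmetic of ranks in this form. *)
Lemma C4_orient : C4 A -> exists2 r : A -> nat, injective r &
  forall x y z, htR x y z = orient r (fun _ _ _ => true) x y z.
Proof.
move=> [_ _ [le le_lin hE]]; have [r ri leE] := linear_order_rank le_lin.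
exists r => // x y z; rewrite (hypertournament_orient ri htA).
apply: (orient_map (f := id) ri) => // {}x {}y {}z xy yz.
rewrite -(mem_hyperedges ri leE) // hE //.
have U : uniq [:: x; y; z] by rewrite /= !inE -!(inj_eq ri); lia.
have -> : #|[set x; y; z]| = #|[:: x; y; z]| by apply: eq_card => u; rewrite !inE orbA.
by rewrite (card_uniqP U).
Qed.

(** For points listed in increasing order this is the parity of the number of hyperedges. *)
Definition parity4 (a b c d : A) := htR a b c (+) htR a b d (+) htR a c d (+) htR b c d.

Lemma C4_parity (a b c d : A) : C4 A -> uniq [:: a; b; c; d] -> parity4 a b c d = false.
Proof.
move=> /C4_orient[r ri RE] /=; rewrite !inE -!(inj_eq ri) /parity4 !RE.
rewrite /orient /oriented /unoriented.
case: (ltngtP (r a) (r b)); case: (ltngtP (r b) (r c)); case: (ltngtP (r c) (r d));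
 case: (ltngtP (r a) (r c)); case: (ltngtP (r a) (r d)); case: (ltngtP (r b) (r d)) => //=; lia.
Qed.

(** The cyclic order cut at [v] is a linear order whose increasing triples lie in [R]. *)
Lemma C4_transitive (v x y z : A) : C4 A -> htR v x y -> htR v y z -> htR v x z && htR x y z.
Proof.
move=> /C4_orient[r ri RE]; rewrite !RE /orient /oriented /unoriented; lia.
Qed.

(** The even permutation [p] exchanges [a] with [b] and [c] with [d], so
    [htR a b c = htR b a d = ~~ htR a b d] and [htR a c d = htR b d c = ~~ htR b c d]: each pair
    contributes exactly one. *)
Lemma H4_parity (a b c d : A) : H4 A -> uniq [:: a; b; c; d] -> parity4 a b c d = false.
Proof.
move=> [_ _ autA] U; have U' : uniq [:: d; c; b; a] by rewrite -rev_uniq.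
move: (U) (U'); rewrite /= !inE !negb_or !andbT.
move=> /andP[/and3P[ab ac ad] /andP[/andP[bc bd] cd]].
move=> /andP[/and3P[dc db da] /andP[/andP[cb ca] ba]].
have N := (negbTE ab, negbTE ac, negbTE ad, negbTE bc, negbTE bd, negbTE cd,
           negbTE dc, negbTE db, negbTE da, negbTE cb, negbTE ca, negbTE ba).
pose p := (tperm a b * tperm c d)%g.
have /mem_automorphisms pR : p \in automorphisms A.
  by rewrite autA Alt_even odd_permM !odd_tperm ab cd.
have E x y z : (tperm x y z : A) = if z == x then y else if z == y then x else z by rewrite permE.
have [pa pb] : p a = b /\ p b = a by rewrite !permM !E ?eqxx ?N ?eqxx ?N.
have [pc pd] : p c = d /\ p d = c by rewrite !permM !E ?eqxx ?N ?eqxx ?N ?eqxx.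
have abd : uniq [:: a; b; d] by rewrite /= !inE !N.
have bcd : uniq [:: b; c; d] by rewrite /= !inE !N.
rewrite /parity4 -(pR a b c) -(pR a c d) pa pb pc pd.
rewrite (hypertournament_perms htA abd) (hypertournament_perms htA bcd).
by case: htR; case: htR.
Qed.

Hypothesis card_A : #|A| = 4.

Lemma C4_rank (r : A -> nat) : injective r ->
  (forall x y z, r x < r y -> r y < r z -> htR x y z) -> C4 A.
Proof.
move=> ri rR; split=> //; exists (fun x y => r x <= r y); first exact: rank_linear_order.
move=> X /(incr_triple ri)[a [b [c [ab bc ->]]]].
by rewrite (mem_hyperedges ri) // rR.
Qed.

Lemma C4_quadruple (a b c d : A) : uniq [:: a; b; c; d] -> (forall x, x \in [:: a; b; c; d]) ->
  htR a b c -> htR a b d -> htR a c d -> htR b c d -> C4 A.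
Proof.
move=> U all4 abc abd acd bcd; set s := [:: a; b; c; d] in U all4.
apply: (@C4_rank (index^~ s)) => [x y|x y z]; first exact: index_inj.
have h i j l : i < j -> j < l -> l < 4 -> htR (nth a s i) (nth a s j) (nth a s l).
  by case: i j l => [|[|[|?]]] [|[|[|?]]] [|[|[|[|?]]]].
by move=> xy yz; have := h _ _ _ xy yz; rewrite !nth_index //; apply;
  rewrite -[4]/(size s) index_mem.
Qed.

(* In [H4] the triples are the faces of a coherently oriented tetrahedron, so every
   transposition reverses all of them. *)
Lemma H4_tetrahedron : (forall x y z w : A, uniq [:: x; y; z; w] -> htR y x w = htR x y z) -> H4 A.
Proof.
move=> tet; split=> //.
have [r ri] : exists r : A -> nat, injective r.
  by exists (fun x => nat_of_ord (enum_rank x)) => x y /val_inj/enum_rank_inj.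
have [a [b [c [d [ab bc cd all4]]]]] := incr_quadruple ri card_A.
have fourth (x y z : A) : uniq [:: x; y; z] -> exists w, uniq [:: x; y; z; w].
  move=> U; have : ~~ [forall w, w \in [:: x; y; z]].
    apply/negP => /forallP h; have := card_uniqP U; rewrite (eq_card (B := predT)) => [|w].
      by rewrite cardE -cardT card_A.
    by rewrite h.
  by case/forallPn => w wN; exists w; rewrite -(rot_uniq 3) /rot /= wN.
have tpR (u v x y z : A) : u != v -> uniq [:: x; y; z] ->
    htR (tperm u v x) (tperm u v y) (tperm u v z) = ~~ htR x y z.
  move=> uv Uxyz; have [w U] := fourth _ _ _ Uxyz.
  have U' : uniq [:: w; z; y; x] by rewrite -rev_uniq.
  have all' t : t \in [:: x; y; z; w].
    suff -> : [:: x; y; z; w] =i predT by [].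
    by apply/subset_cardP; [rewrite (card_uniqP U) /= -card_A; apply: eq_card | apply/subsetP].
  move: (U) (U'); rewrite /= !inE !negb_or !andbT.
  move=> /andP[/and3P[xy xz xw] /andP[/andP[yz yw] zw]].
  move=> /andP[/and3P[wz wy wx] /andP[/andP[zy zx] yx]].
  have N := (negbTE xy, negbTE xz, negbTE xw, negbTE yz, negbTE yw, negbTE zw,
             negbTE wz, negbTE wy, negbTE wx, negbTE zy, negbTE zx, negbTE yx).
  have E (i j l : A) : (tperm i j l : A) = if l == i then j else if l == j then i else l.
    by rewrite permE.
  have P1 := hypertournament_perms htA Uxyz.
  have Uyxw : uniq [:: y; x; w] by rewrite /= !inE !N.
  have Uzyw : uniq [:: z; y; w] by rewrite /= !inE !N.
  have Uxzw : uniq [:: x; z; w] by rewrite /= !inE !N.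
  have P2 := hypertournament_perms htA Uyxw.
  have P3 := hypertournament_perms htA Uzyw.
  have P4 := hypertournament_perms htA Uxzw.
  have T1 : htR y x w = htR x y z by apply: tet.
  have T2 : htR z y w = htR x y z by rewrite (tet y z x w) ?P1 //= !inE !N.
  have T3 : htR x z w = htR x y z by rewrite (tet z x y w) ?P1 //= !inE !N.
  move: uv; have := all' v; have := all' u; rewrite !inE.
  by case/or4P => /eqP-> /or4P[] /eqP->; rewrite ?eqxx // => _;
    rewrite !E ?eqxx ?N ?eqxx ?N ?eqxx ?P1 ?P2 ?P3 ?P4 ?T1 ?T2 ?T3 ?negbK.
(* Every transposition reverses orientation, so a permutation acts by its sign and the automorphisms
   are the even permutations. *)
have pR (p : {perm A}) (x y z : A) : uniq [:: x; y; z] ->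
    htR (p x) (p y) (p z) = odd_perm p (+) htR x y z.
  have [ts -> ts_neq] := prod_tpermP p.
  elim: ts ts_neq x y z => [|[u v] ts IH] /= ts_neq x y z U.
    by rewrite big_nil !perm1 odd_perm1.
  have /andP[uv ts_neq'] := ts_neq.
  rewrite big_cons !permM IH //; last by move: U; rewrite /= !inE !(inj_eq perm_inj).
  by rewrite tpR // odd_permM odd_tperm uv addNb addbN.
have abcU : uniq [:: a; b; c].
  by rewrite /= !inE -!(inj_eq ri); lia.
apply/setP => p; rewrite Alt_even; apply/mem_automorphisms/idP => [/(_ a b c)|podd x y z].
  by rewrite pR //; case: odd_perm; case: htR.
have [U|N] := boolP (uniq [:: x; y; z]); first by rewrite pR // (negbTE podd).
have /hypertournamentP[Ru _ _] := htA.
have N' : ~~ uniq [:: p x; p y; p z] by move: N; rewrite /= !inE !(inj_eq perm_inj).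
by apply/idP/idP => /Ru; [rewrite (negbTE N') | rewrite (negbTE N)].
Qed.

(** Of the eight even sign patterns, six admit a relisting of the points with all four triples
    positive; the two alternating ones are coherently oriented tetrahedra. *)
Lemma parity4_cases (a b c d : A) :
  uniq [:: a; b; c; d] -> (forall x, x \in [:: a; b; c; d]) ->
  parity4 a b c d = false -> C4 A \/ H4 A.
Proof.
move=> U all4; have U' : uniq [:: d; c; b; a] by rewrite -rev_uniq.
move: (U) (U'); rewrite /= !inE !negb_or !andbT.
move=> /andP[/and3P[ab ac ad] /andP[/andP[bc bd] cd]].
move=> /andP[/and3P[dc db da] /andP[/andP[cb ca] ba]].
have N := (negbTE ab, negbTE ac, negbTE ad, negbTE bc, negbTE bd, negbTE cd,
           negbTE dc, negbTE db, negbTE da, negbTE cb, negbTE ca, negbTE ba).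
have Uabc : uniq [:: a; b; c] by rewrite /= !inE !N.
have Uabd : uniq [:: a; b; d] by rewrite /= !inE !N.
have Uacd : uniq [:: a; c; d] by rewrite /= !inE !N.
have Ubcd : uniq [:: b; c; d] by rewrite /= !inE !N.
have P1 := hypertournament_perms htA Uabc.
have P2 := hypertournament_perms htA Uabd.
have P3 := hypertournament_perms htA Uacd.
have P4 := hypertournament_perms htA Ubcd.
have cyc x y z w : uniq [:: x; y; z; w] -> {subset [:: a; b; c; d] <= [:: x; y; z; w]} ->
    [&& htR x y z, htR x y w, htR x z w & htR y z w] -> C4 A \/ H4 A.
  by move=> Ux sx /and4P[h1 h2 h3 h4]; left; apply: (@C4_quadruple x y z w) => // t; apply: sx.
have tetra : htR a b d = ~~ htR a b c -> htR a c d = htR a b c -> htR b c d = ~~ htR a b c ->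
    C4 A \/ H4 A.
  move=> E2 E3 E4; right; apply: H4_tetrahedron => x y z w.
  have := all4 x; have := all4 y; have := all4 z; have := all4 w; rewrite !inE.
  by case/or4P => /eqP-> /or4P[] /eqP-> /or4P[] /eqP-> /or4P[] /eqP->;
    rewrite /= !inE ?eqxx ?N //= => _; rewrite ?P1 ?P2 ?P3 ?P4 ?E2 ?E3 ?E4 ?negbK.
have sub4 x y z w : [&& a \in [:: x; y; z; w], b \in [:: x; y; z; w],
    c \in [:: x; y; z; w] & d \in [:: x; y; z; w]] -> {subset [:: a; b; c; d] <= [:: x; y; z; w]}.
  by move=> h; apply/allP; rewrite /= andbT.
rewrite /parity4; case E1: (htR a b c); case E2: (htR a b d); case E3: (htR a c d);
  case E4: (htR b c d) => //= _.
- by apply: (cyc a b c d); rewrite ?E1 ?E2 ?E3 ?E4 //; apply: sub4; rewrite !inE !eqxx !orbT.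
- by apply: (cyc a b d c); [by rewrite /= !inE !N | by apply: sub4; rewrite !inE !eqxx !orbT |];
    rewrite ?P1 ?P2 ?P3 ?P4 E1 E2 E3 E4.
- by apply: tetra; rewrite ?E1.
- by apply: (cyc a d b c); [by rewrite /= !inE !N | by apply: sub4; rewrite !inE !eqxx !orbT |];
    rewrite ?P1 ?P2 ?P3 ?P4 E1 E2 E3 E4.
- by apply: (cyc a c b d); [by rewrite /= !inE !N | by apply: sub4; rewrite !inE !eqxx !orbT |];
    rewrite ?P1 ?P2 ?P3 ?P4 E1 E2 E3 E4.
- by apply: tetra; rewrite ?E1.
- by apply: (cyc a c d b); [by rewrite /= !inE !N | by apply: sub4; rewrite !inE !eqxx !orbT |];
    rewrite ?P1 ?P2 ?P3 ?P4 E1 E2 E3 E4.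
- by apply: (cyc d c b a); [by rewrite /= !inE !N | by apply: sub4; rewrite !inE !eqxx !orbT |];
    rewrite ?P1 ?P2 ?P3 ?P4 E1 E2 E3 E4.
Qed.

(** The parity is odd in every listing: were it even in one, [A] would be [C4] or [H4], whose parity
    is even in all listings. *)
Lemma O4_parity (a b c d : A) : uniq [:: a; b; c; d] -> parity4 a b c d -> O4 A.
Proof.
move=> U podd; split=> // le le_lin; have [r ri leE] := linear_order_rank le_lin.
have [x [y [z [w [xy yz zw all4]]]]] := incr_quadruple ri card_A.
have xz := ltn_trans xy yz; have yw := ltn_trans yz zw; have xw := ltn_trans xy yw.
have Ux : uniq [:: x; y; z; w] by rewrite /= !inE -!(inj_eq ri); lia.
have pxyzw : parity4 x y z w.
  case E: (parity4 x y z w) => //; move: podd.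
  by have [/C4_parity->|/H4_parity->] := parity4_cases Ux all4 E.
have or4 t : [|| t == x, t == y, t == z | t == w] by have := all4 t; rewrite !inE.
pose faces := [:: [set x; y; z]; [set x; y; w]; [set x; z; w]; [set y; z; w]].
have neq (i j : A) : r i < r j -> (i == j = false) * (j == i = false).
  by move=> ij; split; rewrite -(inj_eq ri); lia.
have N := (neq _ _ xy, neq _ _ yz, neq _ _ zw, neq _ _ xz, neq _ _ yw, neq _ _ xw).
have Ufaces : uniq faces.
  have ne (X Y : {set A}) i : i \in X -> i \notin Y -> (X == Y) = false.
    by move=> iX iY; apply/eqP => XY; rewrite -XY iX in iY.
  rewrite /= !inE (ne _ _ z) ?(ne [set x; y; z] [set x; z; w] y) ?(ne [set x; y; z] [set y; z; w] x)
    ?(ne [set x; y; w] [set x; z; w] y) ?(ne [set x; y; w] [set y; z; w] x)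
    ?(ne [set x; z; w] [set y; z; w] x) //; by rewrite !inE ?eqxx ?N ?orbT.
(* Hyperedges are counted among the four faces, which are pairwise distinct. *)
have -> : #|hyperedges le| = size [seq X <- faces | X \in hyperedges le].
  rewrite -(card_uniqP _) ?filter_uniq //; apply: eq_card => X; rewrite mem_filter.
  apply/idP/andP => [XE|[]//]; split=> //.
  have /(hyperedgesP ri leE)[i [j [l [-> ij jl _]]]] := XE.
  move: ij jl; have := or4 i; have := or4 j; have := or4 l.
  by case/or4P => /eqP-> /or4P[] /eqP-> /or4P[] /eqP->; rewrite ?ltnn //; try lia;
    rewrite /faces !inE eqxx ?orbT.
rewrite size_filter /= !(mem_hyperedges ri leE) // addn0 !oddD !oddb.
by move: pxyzw; rewrite /parity4 !addbA.
Qed.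

End FourPoints.

(** * Expansions *)

Definition expand (L M : language) (A : structure L)
    (j : forall s : M, pred ((arity s).-tuple A)) : structure (language_add L M) :=
  @Structure (language_add L M) A
    (fun s => match s with inl s => @interp L A s | inr s => j s end).

Lemma reduct_expand (L M : language) (A : structure L)
    (j : forall s : M, pred ((arity s).-tuple A)) : reduct (expand j) = A.
Proof. by case: A j. Qed.

Lemma four_constrained_quadruple S (A : structure ht_language) (a b c d : A) :
  four_constrained S A -> uniq [:: a; b; c; d] ->
  exists (X : {set A}) (K : class ht_language) (a' b' c' d' : induced X),
  [/\ List.In K S /\ K (induced X), #|induced X| = 4, uniq [:: a'; b'; c'; d'] &
      [/\ val a' = a, val b' = b, val c' = c & val d' = d]].
Proof.
move=> [_ AS] U; pose X := [set a; b; c; d].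
have X4 : #|X| = 4.
  have -> : #|X| = #|[:: a; b; c; d]| by apply: eq_card => u; rewrite !inE !orbA.
  by rewrite (card_uniqP U).
have [K KS KX] := AS X X4.
have aX : a \in X by rewrite !inE eqxx.
have bX : b \in X by rewrite !inE eqxx !orbT.
have cX : c \in X by rewrite !inE eqxx !orbT.
have dX : d \in X by rewrite !inE eqxx !orbT.
exists X, K, (exist _ a aX), (exist _ b bX), (exist _ c cX), (exist _ d dX).
by rewrite card_induced; split=> //; rewrite -(map_inj_uniq val_inj).
Qed.

Lemma expansion_ordered_cyclic : expansion_of cyclic_class ordered_cyclic.
Proof.
split=> [A [HA /linear_order_rank[r ri leE] Ac]|A CA].
  split=> // X X4; exists C4; first by left.
  have cX := card_induced X; rewrite X4 in cX.
  apply: (C4_rank (induced_hypertournament X HA) cX (r := fun x => r (val x))).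
  - by move=> x y /ri/val_inj.
  - by move=> x y z xy yz; rewrite htR_induced; apply: Ac; rewrite (strict_rank _ _ ri leE).
have [HA _] := CA; have /hypertournamentP[Ru Rr Ra] := HA.
have Rneq (x y z : A) : htR x y z -> (x == y = false) * (x == z = false) * (y == z = false).
  by move/Ru; rewrite /= !inE; case: eqP; case: eqP; case: eqP.
(* Transitivity is transported from the [C4] induced on the four points; [x = z] is excluded because
   it would reverse [htR v x y]. *)
have trans (v x y z : A) : htR v x y -> htR v y z -> htR v x z && htR x y z.
  move=> vxy vyz; have xz : x != z.
    by apply/eqP => xz; move: vyz; rewrite -xz (Ra _ _ _ (Ru _ _ _ vxy)) vxy.
  have U : uniq [:: v; x; y; z].
    by rewrite /= !inE !(Rneq _ _ _ vxy) !(Rneq _ _ _ vyz) (negbTE xz).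
  have [X [K [v' [x' [y' [z' [[[<-//|//] C4X] X4 U' [ev ex ey ez]]]]]]]] :=
    four_constrained_quadruple CA U.
  have := @C4_transitive _ (induced_hypertournament X HA) v' x' y' z' C4X.
  by rewrite !htR_induced ev ex ey ez; apply.
have [le le_lin leR_] : exists2 le : rel A, linear_order le &
    forall x y z : A, strict le x y -> strict le y z -> htR x y z.
  case: (pickP (mem A)) => [v _|A0]; last first.
    by exists (fun _ _ => true); [split=> x; have := A0 x | move=> x; have := A0 x].
  (* The cut at [v]: it comes first, and the other points are compared through [htR v]. *)
  pose le (x y : A) := [|| x == y, x == v | htR v x y].
  have R0 (x : A) : htR v x v = false by apply/negP => /Rneq; rewrite eqxx => -[[]].
  have lt_cases x y : strict le x y -> x = v /\ y <> v \/ htR v x y.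
    rewrite /strict /le; case: eqVneq => //= xy /predU1P[xv|]; last by right.
    by left; split=> // yv; rewrite xv yv eqxx in xy.
  exists le; first split.
  - by move=> x; rewrite /le eqxx.
  - move=> x y /andP[]; rewrite /le; case: eqVneq => //= xy.
    case: (eqVneq x v) => [->|xv]; first by rewrite R0 orbF => _ /eqP.
    case: (eqVneq y v) => [->|yv]; first by rewrite R0.
    by rewrite !orFb => vxy; rewrite (Ra _ _ _ (Ru _ _ _ vxy)) vxy.
  - move=> y x z; rewrite /le; case: (eqVneq x y) => [->//|xy] /=.
    case: (eqVneq x v) => [->|xv] /=; first by rewrite orbT.
    case: (eqVneq y z) => [->|yz] /=; first by move=> ->; rewrite orbT.
    case: (eqVneq y v) => [->|yv] /=; first by rewrite R0.
    by move=> vxy vyz; have /andP[->] := trans _ _ _ _ vxy vyz; rewrite orbT.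
  - move=> x y; rewrite /le; case: (eqVneq x y) => //= xy.
    case: (eqVneq x v) => //= xv; case: (eqVneq y v) => [|yv] /=; first by rewrite !orbT.
    rewrite [htR v y x]Ra ?orbA ?orbT //; first by case: htR; rewrite ?orbT.
    by rewrite /= !inE (eq_sym v) (eq_sym v) (negbTE xv) (negbTE yv) (negbTE xy).
  - move=> x y z /lt_cases[[-> yv]|vxy] /lt_cases[[yv' _]|] //.
      by rewrite yv' R0 in vxy.
    by move=> vyz; have /andP[] := trans _ _ _ _ vxy vyz.
exists (expand (fun s : order_language => pair_interp le)); last exact: reduct_expand.
by split.
Qed.

(** The parity decides the type of each four-point substructure, and any linear order may be
    added. *)
Lemma expansion_ordered_hypertournaments : expansion_of all_class ordered_hypertournaments.
Proof.
split=> [A [HA _]|A [HA _]].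
  split=> // X X4; have HX := induced_hypertournament X HA.
  have cX := card_induced X; rewrite X4 in cX.
  have [r ri] : exists r : induced X -> nat, injective r.
    by exists (fun x => nat_of_ord (enum_rank x)) => x y /val_inj/enum_rank_inj.
  have [a [b [c [d [ab bc cd all4]]]]] := incr_quadruple ri cX.
  have U : uniq [:: a; b; c; d] by rewrite /= !inE -!(inj_eq ri); lia.
  case E: (parity4 a b c d).
    by exists O4; [right; left | apply: O4_parity E].
  have [|] := parity4_cases HX cX U all4 E => KX.
    by exists C4; [left |].
  by exists H4; [right; right; left |].
exists (expand (fun s : order_language => pair_interp (fun x y : A => enum_rank x <= enum_rank y))).
  split; first by rewrite reduct_expand.
  by apply: (@rank_linear_order A (fun x => enum_rank x)) => x y /val_inj/enum_rank_inj.
exact: reduct_expand.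
Qed.

Lemma expansion_ordered_even : expansion_of even_class ordered_even.
Proof.
split=> [A [/linear_order_rank[r ri leE] _ HA Ae]|A EA].
  split=> // X X4; have HX := induced_hypertournament X HA.
  have cX := card_induced X; rewrite X4 in cX.
  have r'i : injective (fun x : induced X => r (val x)) by move=> x y /ri/val_inj.
  have [a [b [c [d [ab bc cd all4]]]]] := incr_quadruple r'i cX.
  have U : uniq [:: a; b; c; d] by rewrite /= !inE -!(inj_eq r'i); lia.
  have RE (x y z : induced X) : r (val x) < r (val y) -> r (val y) < r (val z) ->
      htR x y z = ~~ odd (ogE (val x) (val y) + ogE (val y) (val z) + ogE (val x) (val z)).
    by move=> xy yz; rewrite htR_induced; have [] := Ae (val x) (val y) (val z);
      rewrite ?(strict_rank _ _ ri leE).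
  have ac := ltn_trans ab bc; have bd := ltn_trans bc cd; have ad := ltn_trans ab bd.
  (* Each of the six pairs lies in two of the four triples, and the four negations cancel. *)
  have E : parity4 a b c d = false.
    rewrite /parity4 !RE // !oddD !oddb.
    by do 6!case: (ogE _ _).
  have [|] := parity4_cases HX cX U all4 E => KX.
    by exists C4; [left |].
  by exists H4; [right; left |].
have [HA _] := EA; have /hypertournamentP[Ru Rr Ra] := HA.
have parity (a b c d : A) : uniq [:: a; b; c; d] -> parity4 a b c d = false.
  move=> U; have [X [K [a' [b' [c' [d' [[KS KX] X4 U' [ea eb ec ed]]]]]]]] :=
    four_constrained_quadruple EA U.
  have HX := induced_hypertournament X HA.
  have <- : parity4 a' b' c' d' = parity4 a b c d by rewrite /parity4 !htR_induced ea eb ec ed.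
  by case: KS KX => [<-|[<-|//]] KX; [apply: C4_parity | apply: H4_parity].
(* Switching class representative isolating [v]: [e] is the link of [v] in the two-graph. *)
have [r [e [ri e_irr e_sym eE]]] : exists (r : A -> nat) (e : rel A),
    [/\ injective r, irreflexive e, symmetric e &
        forall x y z, r x < r y -> r y < r z -> htR x y z = even_triple e x y z].
  case: (pickP (mem A)) => [v _|A0]; last first.
    by exists (fun _ => 0), (fun _ _ => false); split=> // x; have := A0 x.
  (* With [v] ranked first and isolated in [e], the triple [v, y, z] is even exactly when [e y z]
     fails. *)
  pose r (x : A) := if x == v then 0 else (enum_rank x).+1.
  pose e (x y : A) := if r x < r y then (x != v) && ~~ htR v x y
                else if r y < r x then (y != v) && ~~ htR v y x else false.
  have r_inj : injective r.
    move=> x y; rewrite /r; case: eqVneq => [->|_]; case: eqVneq => [->|_] //.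
    by case=> /val_inj/enum_rank_inj.
  exists r, e; split=> // [x|x y|x y z xy yz]; first by rewrite /e ltnn.
    by rewrite /e; case: ltngtP.
  have xz := ltn_trans xy yz.
  have notv t u : r t < r u -> u != v by rewrite /r; case: (u == v).
  rewrite /even_triple /e xy yz xz (notv _ _ xy) /=.
  case: (eqVneq x v) => [->|xv] /=; first by rewrite add0n addn0 oddb negbK.
  have U : uniq [:: v; x; y; z].
    rewrite /= !inE !(eq_sym v) (negbTE xv) (negbTE (notv _ _ xy)) (negbTE (notv _ _ yz)).
    by rewrite -!(inj_eq r_inj); lia.
  (* Even parity on [v, x, y, z] expresses [htR x y z] through the three triples containing [v],
     which define [e]. *)
  have := parity _ _ _ _ U; rewrite /parity4 !oddD !oddb.
  by case: (htR v x y); case: (htR v x z); case: (htR v y z); case: (htR x y z).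
pose j (s : order_graph_language) : pred ((arity s).-tuple A) :=
  match s with inl s => pair_interp (fun x y => r x <= r y) | inr s => pair_interp e end.
exists (expand j); last exact: reduct_expand.
split=> //; first exact: rank_linear_order.
move=> x y z; rewrite !(strict_rank (r := r)) // => xy yz.
have xyz := eE x y z xy yz; split; first exact: xyz.
rewrite -[RHS]negbK -/(even_triple e x y z) -xyz.
by apply: Ra; rewrite /= !inE -!(inj_eq ri); lia.
Qed.

Theorem theorem1 :
  [/\ has_finite_ramsey_expansion cyclic_class,
      has_finite_ramsey_expansion even_class &
      has_finite_ramsey_expansion all_class] /\
  [/\ ramsey ordered_cyclic,
      ramsey ordered_even &
      ramsey ordered_hypertournaments] /\
  [/\ expansion_of cyclic_class ordered_cyclic,
      expansion_of even_class ordered_even &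
      expansion_of all_class ordered_hypertournaments].
Proof.
have [Rc Re Rh] := And3 ramsey_ordered_cyclic ramsey_ordered_even ramsey_ordered_hypertournaments.
have [Xc Xe Xh] := And3 expansion_ordered_cyclic expansion_ordered_even
  expansion_ordered_hypertournaments.
split; last by split; split.
split; [exists order_language, ordered_cyclic | exists order_graph_language, ordered_even
       | exists order_language, ordered_hypertournaments]; by split.
Qed.
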